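(* Let $\Phi$ be the continuous semiflow on $X$ generated by the heat equation $u_t=u_{xx}$, $t>0$, $x\in S^1=\mathbb{R}/(2\pi\mathbb{Z})$, $u(0,\cdot)=u_0$, and let $\{\mathcal{C}^i\}_{i=0}^{N}$, $N=+\infty$, be the natural zero-number cones in $X$. For $b>0$ let $$u_0^b(x)=e^b\cos x-\tfrac14e^{4b}\cos2x-\tfrac34 .$$ Then for every $b>0$ one has $u_0^b\in\mathcal{C}^3$ but $\Phi_b u_0^b\in\partial\mathcal{C}^3$. Consequently, $\Phi$ is not uniformly eventually strongly monotone (UESM) with respect to $\{\mathcal{C}^i\}_{i=0}^{N}$.
   Context: **Phase space.** Let $A:D(A)=H^2(S^1)\subset L^2(S^1)\to L^2(S^1)$, $Au=-u_{xx}$. Fix $a>0$ and $\alpha\in(3/4,1)$, and set $X:=D((A+aI)^\alpha)$ with $\|u\|_X:=\|(A+aI)^\alpha u\|_{L^2(S^1)}$; then $X=H^{2\alpha}(S^1)\hookrightarrow C^1(S^1)$. **Zero-number cones.** For $h\in C^1(S^1)$, $z(h):=\#\{x\in S^1:h(x)=0\}$ (with value $+\infty$ if infinite). Set $\mathcal{C}^0=\{0\}$, $\mathcal{C}^N=X$ and, for $1\le i<N=+\infty$, $$\mathcal{C}^i:=\overline{\{h\in X:(h(x),h_x(x))\ne(0,0)\ \text{for every }x\in S^1,\ z(h)\le2(i-1)\}},$$ the closure being taken in $X$; $\partial$ denotes the boundary in $X$. **UESM.** $\Phi$ is UESM with respect to a cone $C$ with nonempty interior if there is $T(C)>0$ such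 that $x-y\in C\setminus\{0\}$ implies $\Phi_t(x)-\Phi_t(y)\in\operatorname{Int}C$ for all $t\ge T(C)$. It is UESM with respect to $\{\mathcal{C}^i\}_{i=0}^N$ if it is UESM with respect to $\mathcal{C}^i$ for every $1\le i<N$. *)

(* Defs.v *)
From HB Require Import structures.
From mathcomp Require Import all_boot all_order all_algebra.
From mathcomp Require Import all_classical all_reals all_analysis.

Set Implicit Arguments.
Unset Strict Implicit.
Unset Printing Implicit Defensive.
Import Order.TTheory GRing.Theory Num.Theory.
Import numFieldNormedType.Exports.
Local Open Scope classical_set_scope.
Local Open Scope ring_scope.

(** Functions on S^1 = R/(2 pi Z) are 2pi-periodic functions on R; integrals
    and L^2 norms are taken over the fundamental domain [0, 2pi]. *)

Section Circle.
Context {R : realType}.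
Implicit Types u v e f g phi : R -> R.

Lemma measurable_circle : measurable (`[0, 2 * pi] : set R).
Proof. exact: measurable_itv. Qed.

Definition circle_measure : {measure set (measurableTypeR R) -> \bar R} :=
  mrestr (@lebesgue_measure R) measurable_circle.

(* Elements of L^2(S^1) are represented by functions; nothing below depends on
   their values on a null set or outside of [0, 2pi]. *)
Definition L2 : {pred R -> R} := Lfun circle_measure 2%:E.

Definition L2norm u : R := fine ('N[circle_measure]_2%:E[EFin \o u])%E.

Definition inner u v : R := (\int[circle_measure]_x (u x * v x))%R.

Definition test_function phi : Prop :=
  periodic phi (2 * pi) /\ forall n x, derivable (derive1n n phi) x 1.

(* g is the derivative of u in the sense of distributions on S^1 *)
Definition weak_derivative u g : Prop :=
  forall phi, test_function phi -> inner u (derive1 phi) = - inner g phi.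

(* The graph of A : H^2(S^1) -> L^2(S^1), A u = - u_xx *)
Definition opA u f : Prop :=
  [/\ u \in L2, f \in L2 &
      exists g, [/\ g \in L2, weak_derivative u g & weak_derivative g (- f)]].

Definition eigenpairA (lambda : R) e : Prop := opA e (lambda *: e).

(* The graph of (A + a I)^alpha, by the spectral theorem: A is self-adjoint and
   its eigenfunctions span L^2(S^1), so v = (A + a I)^alpha u means that v has
   coefficient (lambda + a)^alpha <u, e> along each eigenfunction e. *)
Definition fracpow (a alpha : R) u v : Prop :=
  [/\ u \in L2, v \in L2 &
      forall lambda e, eigenpairA lambda e ->
        inner v e = (lambda + a) `^ alpha * inner u e].

Definition C1 u : Prop :=
  (forall x, derivable u x 1) /\ continuous (derive1 u).

(* An element of X = D((A + a I)^alpha) = H^{2 alpha}(S^1) is represented by its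
   C^1 representative, which exists (and is unique) when 3/4 < alpha. *)
Definition inX (a alpha : R) : {pred R -> R} :=
  mem [set u | periodic u (2 * pi) /\ C1 u /\ exists v, fracpow a alpha u v].

(* Points of S^1 are counted by their representatives in [0, 2pi); counting is
   +oo on infinite sets. *)
Definition zero_number u : \bar R :=
  counting [set x | 0 <= x < 2 * pi /\ u x = 0].

Definition u0 (b : R) : R -> R := fun x =>
  expR b * cos x - 4^-1 * expR (4 * b) * cos (2 * x) - 3 / 4.

Lemma inner_linear c u v e : u \in L2 -> v \in L2 -> e \in L2 ->
  inner (c *: u + v) e = c * inner u e + inner v e.
Proof.
move=> uL vL eL; rewrite /inner.
have iu := (Lfun1_integrable _ _).1 (Lfun2_mul_Lfun1 uL eL).
have iv := (Lfun1_integrable _ _).1 (Lfun2_mul_Lfun1 vL eL).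
rewrite -RintegralZl// -RintegralD//.
- by apply: eq_Rintegral => x _; rewrite /= mulrDl mulrA.
- by have := integrableZl measurableT c iu; apply: eq_integrable.
Qed.

Lemma L2_linear c u v : u \in L2 -> v \in L2 -> c *: u + v \in L2.
Proof.
have p1 : (1 <= 2%:E :> \bar R)%E by rewrite lee_fin ler1n.
have := (Lfun_submod_closed circle_measure p1).2 c u v; exact.
Qed.

Lemma L2_0 : 0 \in L2.
Proof.
have p1 : (1 <= 2%:E :> \bar R)%E by rewrite lee_fin ler1n.
have := (Lfun_submod_closed circle_measure p1).1; exact.
Qed.

Lemma L2norm_opp v : L2norm (- v) = L2norm v.
Proof.
rewrite /L2norm (_ : _ \o _ = \- (EFin \o v))%E//.
by rewrite (oppe_Lnorm circle_measure (EFin \o v) 2%:E).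
Qed.

Lemma L2norm_add u v : u \in L2 -> v \in L2 ->
  L2norm (u + v) <= L2norm u + L2norm v.
Proof.
have p1 : (1 <= 2%:E :> \bar R)%E by rewrite lee_fin ler1n.
by move=> uL vL; exact: (ler_LnormD (Lfun_Sub p1 uL) (Lfun_Sub p1 vL)).
Qed.

Lemma L2norm0 : L2norm 0 = 0.
Proof.
by rewrite /L2norm (_ : _ \o _ = cst 0%E)// Lnorm0//.
Qed.

Lemma L2norm_ge0 v : 0 <= L2norm v.
Proof. by rewrite /L2norm fine_ge0// Lnorm_ge0. Qed.

Lemma fracpow_linear a alpha c u v u' v' :
  fracpow a alpha u v -> fracpow a alpha u' v' ->
  fracpow a alpha (c *: u + u') (c *: v + v').
Proof.
move=> [uL vL uv] [u'L v'L uv']; split; [exact: L2_linear..|].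
move=> l e le; have eL : e \in L2 by case: le.
by rewrite !inner_linear// (uv _ _ le) (uv' _ _ le) mulrDr mulrCA.
Qed.

Lemma fracpow0 a alpha : fracpow a alpha 0 0.
Proof.
split; [exact: L2_0..|] => l e _; rewrite /inner.
by rewrite /Rintegral; under eq_integral do rewrite /= mul0r; rewrite integral0 mulr0.
Qed.

Lemma inX_submod_closed a alpha : submod_closed (inX a alpha).
Proof.
split.
  rewrite inE; split; [by []|split; [split|by exists 0; exact: fracpow0]].
    by move=> x; exact: derivable_cst.
  by rewrite (_ : derive1 _ = cst 0); [exact: cst_continuous|
    apply/funext => x; rewrite (_ : 0 = cst 0)// derive1_cst].
move=> c u u'; rewrite !inE => -[up [[ud uc] [v uv]]] [u'p [[u'd u'c] [v' uv']]].
split; [|split; [split|]].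
- by move=> x; rewrite /= /GRing.add /= /GRing.scale /= up u'p.
- by move=> x; apply: derivableD => //; exact: derivableZ.
- rewrite (_ : derive1 _ = c *: derive1 u + derive1 u').
    by move=> x; apply: continuousD; [|exact: u'c];
    apply: (@continuousM _ _ (cst c) (derive1 u)); [exact: cst_continuous|exact: uc].
  apply/funext => x; rewrite derive1E deriveD//; last exact: derivableZ.
  by rewrite deriveZ// -!derive1E.
- by exists (c *: v + v'); exact: fracpow_linear.
Qed.

HB.instance Definition _ a alpha :=
  GRing.isSubmodClosed.Build R (R -> R) (inX a alpha)
    (inX_submod_closed a alpha).

End Circle.

Record X (R : realType) (a alpha : R) := InX {
  X_fun :> R -> R ;
  X_funP : X_fun \in inX a alpha }.

HB.instance Definition _ (R : realType) (a alpha : R) :=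
  [isSub for @X_fun R a alpha].
HB.instance Definition _ (R : realType) (a alpha : R) :=
  [Choice of X a alpha by <:].
HB.instance Definition _ (R : realType) (a alpha : R) :=
  [SubChoice_isSubLmodule of X a alpha by <:].

Section PhaseSpace.
Context {R : realType} (a alpha : R).
Local Notation X := (X a alpha).
Implicit Types u w : X.

(* ||u||_X := ||(A + a I)^alpha u||_{L^2}. As (A + a I)^alpha u is determined up
   to a null set, the infimum is that of a singleton. *)
Definition normX u : R := inf [set L2norm v | v in fracpow a alpha u].

Lemma normX_lbound u : has_lbound [set L2norm v | v in fracpow a alpha u].
Proof. by exists 0 => _ [v _ <-]; exact: L2norm_ge0. Qed.

Lemma fracpow_ex u : exists v, fracpow a alpha u v.
Proof. by have := X_funP u; rewrite inE => -[_ [_]]. Qed.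

Lemma normX_has_inf u : has_inf [set L2norm v | v in fracpow a alpha u].
Proof.
split; last exact: normX_lbound.
by have [v uv] := fracpow_ex u; exists (L2norm v), v.
Qed.

Lemma normX_le u v : fracpow a alpha u v -> normX u <= L2norm v.
Proof. by move=> uv; apply: ge_inf; [exact: normX_lbound|exists v]. Qed.

Lemma normX0 : normX 0 = 0.
Proof.
apply/eqP; rewrite eq_le; apply/andP; split.
  by rewrite -L2norm0; apply: normX_le; exact: fracpow0.
by apply: lb_le_inf; [exact: (normX_has_inf 0).1|
  move=> _ [v _ <-]; exact: L2norm_ge0].
Qed.

Lemma normX_opp u : normX (- u) = normX u.
Proof.
suff le w : normX (- w) <= normX w.
  by apply/eqP; rewrite eq_le le -{1}[u]opprK le.
apply: lb_le_inf; first exact: (normX_has_inf w).1.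
move=> _ [v wv <-]; rewrite -L2norm_opp; apply: normX_le.
have := fracpow_linear (-1) wv (fracpow0 a alpha).
by rewrite !scaleN1r !addr0.
Qed.

Lemma normX_add u w : normX (u + w) <= normX u + normX w.
Proof.
apply/ler_addgt0Pr => e e0; have e20 : 0 < e / 2 by rewrite divr_gt0.
have [_ [v uv <-] vlt] := inf_adherent e20 (normX_has_inf u).
have [_ [v' wv' <-] v'lt] := inf_adherent e20 (normX_has_inf w).
have uwv : fracpow a alpha (u + w : X) (v + v').
  by have := fracpow_linear 1 uv wv'; rewrite !scale1r.
apply: (le_trans (normX_le uwv)).
apply: le_trans (L2norm_add _ _) _; [by case: uv|by case: wv'|].
by rewrite [e]splitr addrACA ltW// ltrD.
Qed.

Definition ballX u (e : R) : set X := [set w | normX (u - w) < e].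

Let entX : set_system (X * X) := entourage_ ballX.
Let nbhsX u : set_system X := nbhs_ entX u.
Let nbhsXE : nbhsX = nbhs_ entX. Proof. by []. Qed.
Let entXE : entX = entourage_ ballX. Proof. by []. Qed.

Let ballX_center u (e : R) : 0 < e -> ballX u e u.
Proof. by rewrite /ballX/= subrr normX0. Qed.

Let ballX_sym u w (e : R) : ballX u e w -> ballX w e u.
Proof. by rewrite /ballX/= -normX_opp opprB. Qed.

Let ballX_triangle u (v : X) w (e1 e2 : R) :
  ballX u e1 v -> ballX v e2 w -> ballX u (e1 + e2) w.
Proof.
rewrite /ballX/= => uv vw.
have -> : u - w = (u - v) + (v - w) by rewrite addrA subrK.
by apply: le_lt_trans (normX_add _ _) _; exact: ltrD.
Qed.

HB.instance Definition _ := hasNbhs.Build X nbhsX.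
HB.instance Definition _ := @Nbhs_isPseudoMetric.Build R X
  entX nbhsXE ballX ballX_center ballX_sym ballX_triangle entXE.

End PhaseSpace.

Section Dynamics.
Context {R : realType} {a alpha : R}.
Local Notation X := (X a alpha).
Implicit Types u w : X.

Definition boundary (C : set X) : set X := closure C `\` C°.

(* None stands for the index N = +oo. *)
Definition cone (i : option nat) : set X :=
  match i with
  | Some 0 => [set 0]
  | Some j => closure [set h : X |
      (forall x, (h x, derive1 h x) <> (0, 0)) /\
      (zero_number h <= (2 * (j - 1))%:R%:E)%E]
  | None => setT
  end.

(* Only times t >= 0 are constrained. *)
Definition continuous_semiflow (Phi : R -> X -> X) : Prop :=
  [/\ forall u, Phi 0 u = u,
      forall s t u, 0 <= s -> 0 <= t -> Phi (s + t) u = Phi s (Phi t u) &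
      {within [set p : R * X | 0 <= p.1], continuous (fun p => Phi p.1 p.2)}].

(* Phi_t u_0 is the classical solution of u_t = u_xx for t > 0 that attains its
   initial value u_0 in X; by the maximum principle it is unique, so Phi is
   determined at all times t >= 0. *)
Definition heat_semiflow (Phi : R -> X -> X) : Prop :=
  continuous_semiflow Phi /\
  forall u t x, 0 < t ->
    derivable (derive1 (Phi t u)) x 1 /\
    is_derive t 1 (fun s => Phi s u x) (derive1n 2 (Phi t u) x).

Definition UESM (Phi : R -> X -> X) (C : set X) : Prop :=
  exists2 T, 0 < T & forall u w, C (u - w) -> u - w != 0 ->
    forall t, T <= t -> C° (Phi t u - Phi t w).

Definition UESM_cones (Phi : R -> X -> X) : Prop :=
  forall i : nat, (1 <= i)%N -> UESM Phi (cone (Some i)).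

End Dynamics.

(* Main.v *)
(** Everything rests on the embedding |u(x)| <= C ||u||_X.  For u in X with
    v = (A + a)^alpha u, the pairing <u, D_N(. - x)> with the Dirichlet kernel equals
    <v, K_N> for a trigonometric polynomial K_N whose L^2 norm is bounded uniformly in N
    and x (sum of k^(-4 alpha)), and it differs from 2 pi u(x) by Fourier coefficients of
    fixed L^2 functions, which vanish on average.  Hence orbits of Phi are jointly
    continuous in (t, x), and the maximum principle forces Phi_t u_0^b = u_0^(b - t).

    As a function of cos x, u_0^b is quadratic with two simple roots in (-1, 1) when
    b > 0, so that it has four zeros on the circle, all simple.  At b = 0 it degenerates to
    - (1 - cos x)^2 / 2, with a zero of order four at 0: adding (20 / N)^4 cos (N x), which
    tends to 0 in X, produces at least five sign changes near 0, and these
    persist under uniformly small, hence under X-small, perturbations.  So Phi_b u_0^b is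
    in the cone but not in its interior. *)

Require Import Defs.
From HB Require Import structures.
From mathcomp Require Import all_boot all_order all_algebra finmap.
From mathcomp Require Import all_classical all_reals all_analysis.
From mathcomp Require Import measurable_realfun ring lra zify.

Set Implicit Arguments.
Unset Strict Implicit.
Unset Printing Implicit Defensive.
Import Order.TTheory GRing.Theory Num.Theory.
Import numFieldNormedType.Exports.
Local Open Scope classical_set_scope.
Local Open Scope ring_scope.

(** * L^2 of the circle *)

Section L2Circle.
Context {R : realType}.
Implicit Types u v w f F : measurableTypeR R -> R.
Local Notation mu := (@lebesgue_measure R).
Local Notation circle := (@circle_measure R).

(** The complement of the interval is null for the restricted measure, and on measurable subsets of
    the interval the two measures agree. *)
Lemma circle_integral (f : measurableTypeR R -> \bar R) : measurable_fun setT f ->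
  (\int[circle]_x f x = \int[mu]_(x in `[0%R, (2 * pi)%R]) f x)%E.
Proof.
move=> mf; have mI : measurable (`[0, 2 * pi] : set (measurableTypeR R)).
  exact: measurable_itv.
transitivity (\int[circle]_(x in `[0%R, (2 * pi)%R]) f x)%E; last first.
  apply: eq_measure_integral => A mA AI.
  by rewrite /circle_measure /= /mrestr; congr (mu _); exact/setIidl.
rewrite [RHS]integral_mkcond; apply: ae_eq_integral => //.
  by apply/(measurable_restrict f) => //; apply: measurable_funTS.
exists (~` `[0, 2 * pi]); split.
- exact: measurableC.
- by rewrite /circle_measure /= /mrestr setICl measure0.
- by move=> x /= h xI; apply: h => _; rewrite patchE mem_set.
Qed.

(** A bound on one period suffices for continuous functions. Asking only measurability also covers
    quotients by a vanishing sine. *)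
Lemma bounded_L2 f (M : R) : measurable_fun setT f ->
  (forall x, 0 <= x <= 2 * pi -> `|f x| <= M) -> f \in L2.
Proof.
move=> mf fM; rewrite inE; apply/andP; split; first by rewrite inE.
rewrite inE /= /finite_norm unlock poweR_lty //.
have mg : measurable_fun setT (fun x => (`|f x| `^ 2)%:E).
  apply/measurable_EFinP; apply: (measurableT_comp (measurable_powR _)).
  exact: measurableT_comp.
rewrite (_ : (fun x => _) = (fun x => (`|f x| `^ 2)%:E)) // circle_integral //.
apply: le_lt_trans (_ : (\int[mu]_(x in `[0%R, (2 * pi)%R]) (M `^ 2)%:E < +oo)%E).
  apply: ge0_le_integral => //; first exact: measurable_funTS.
  move=> x; rewrite /= in_itv /= => /fM fxM; rewrite lee_fin.
  by apply: ge0_ler_powR; rewrite ?nnegrE // (le_trans _ fxM).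
rewrite integral_cst //= lebesgue_measure_itv /= lte_fin mulr_gt0 ?pi_gt0 //.
by rewrite -EFinD -EFinM ltry.
Qed.

Lemma continuous_L2 f : continuous f -> f \in L2.
Proof.
move=> cf; have [|M [_ hM]] := @compact_bounded _ _ (f @` `[0, 2 * pi]).
  apply: continuous_compact; last exact: segment_compact.
  exact: continuous_subspaceT.
apply: (@bounded_L2 _ (M + 1)); first exact: continuous_measurable_fun.
by move=> x xI; apply: (hM (M + 1)); [rewrite ltrDl|exists x; rewrite //= in_itv].
Qed.

Lemma L2D u v : u \in L2 -> v \in L2 -> u + v \in L2.
Proof. by move=> uL vL; have := L2_linear 1 uL vL; rewrite scale1r. Qed.

Lemma L2Z (c : R) u : u \in L2 -> c *: u \in L2.
Proof. by move=> uL; have := L2_linear c uL (L2_0 (R := R)); rewrite addr0. Qed.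

Lemma innerC u v : inner u v = inner v u.
Proof. by apply: eq_Rintegral => x _; rewrite mulrC. Qed.

Lemma inner0l v : inner 0 v = 0.
Proof.
by rewrite /inner /Rintegral; under eq_integral do rewrite /= mul0r; rewrite integral0.
Qed.

Lemma innerDl u v w : u \in L2 -> v \in L2 -> w \in L2 ->
  inner (u + v) w = inner u w + inner v w.
Proof.
by move=> uL vL wL; have := inner_linear 1 uL vL wL; rewrite scale1r mul1r.
Qed.

Lemma innerZl (c : R) u w : u \in L2 -> w \in L2 -> inner (c *: u) w = c * inner u w.
Proof.
by move=> uL wL; have := inner_linear c uL (L2_0 (R := R)) wL;
  rewrite inner0l !addr0.
Qed.

Lemma innerDr u v w : u \in L2 -> v \in L2 -> w \in L2 ->
  inner w (u + v) = inner w u + inner w v.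
Proof. by move=> uL vL wL; rewrite ![inner w _]innerC innerDl. Qed.

Lemma innerZr (c : R) u w : u \in L2 -> w \in L2 -> inner w (c *: u) = c * inner w u.
Proof. by move=> uL wL; rewrite ![inner w _]innerC innerZl. Qed.

Lemma L2norm_sqr u : u \in L2 -> L2norm u ^+ 2 = inner u u.
Proof.
move=> uL; have p1 : (1 <= 2%:E :> \bar R)%E by rewrite lee_fin ler1n.
have E := finite_norm_fine (Lfun_Sub p1 uL).
have N0 : (2 : R) != 0 by [].
have := @powR_Lnorm _ _ _ circle (EFin \o u) 2 N0.
rewrite -[X in (X `^ _)%E]E poweR_EFin powR_mulrn ?L2norm_ge0 // => H.
rewrite /inner /Rintegral.
have -> : (\int[circle]_x (u x * u x)%:E)%E = (L2norm u ^+ 2)%:E.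
  rewrite [RHS]H; apply: eq_integral => x _.
  by rewrite abse_EFin poweR_EFin powR_mulrn // real_normK ?num_real // expr2.
by [].
Qed.

Lemma inner_ge0 u : 0 <= inner u u.
Proof. by apply: Rintegral_ge0 => x _; rewrite -expr2 sqr_ge0. Qed.

Lemma CauchySchwarz_inner u v : u \in L2 -> v \in L2 ->
  `|inner u v| <= L2norm u * L2norm v.
Proof.
move=> uL vL; rewrite -(@ler_sqr R) ?nnegrE ?mulr_ge0 ?L2norm_ge0 ?normr_ge0 //.
rewrite exprMn !L2norm_sqr // real_normK ?num_real //.
have key (s t : R) :
    0 <= s ^+ 2 * inner u u + 2 * s * t * inner u v + t ^+ 2 * inner v v.
  have := inner_ge0 (s *: u + t *: v).
  rewrite innerDl ?innerZl ?innerDr ?innerZr ?L2D ?L2Z // (innerC v u).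
  by congr (0 <= _); ring.
have [v0|vn0] := eqVneq (inner v v) 0.
  have [->|uv0] := eqVneq (inner u v) 0; first by rewrite expr0n mulr_ge0 ?inner_ge0.
  (* If [inner v v = 0], the form is affine in [t]; this [t] gives it the value -1. *)
  have := key 1 (- (inner u u + 1) / (2 * inner u v)).
  rewrite v0 mulr0 addr0 (_ : 1 ^+ 2 * _ + _ = -1) ?ler0N1 //.
  by field; rewrite uv0.
have vp : 0 < inner v v by rewrite lt_def vn0 inner_ge0.
have := key (inner v v) (- inner u v).
rewrite (_ : _ + _ = inner v v * (inner u u * inner v v - inner u v ^+ 2)); last by ring.
by rewrite pmulr_rge0 // subr_ge0.
Qed.

Lemma circle_FTC (F f : R -> R) : (forall x : R, is_derive x 1 F (f x)) -> continuous f ->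
  \int[circle]_x f x = F (2 * pi) - F 0.
Proof.
move=> Ff cf; have pi2 : 0 < 2 * pi :> R by rewrite mulr_gt0 ?pi_gt0.
have cF : continuous F.
  move=> x; apply/differentiable_continuous/derivable1_diffP.
  exact: (@ex_derive _ _ _ _ _ _ _ (Ff x)).
rewrite /Rintegral circle_integral; last first.
  by apply/measurable_EFinP; exact: continuous_measurable_fun.
rewrite (@continuous_FTC2 _ f F) //.
- exact: continuous_subspaceT.
- split; first by move=> x _; exact: (@ex_derive _ _ _ _ _ _ _ (Ff x)).
    by apply: cvg_at_right_filter; exact: cF.
  by apply: cvg_at_left_filter; exact: cF.
- by move=> x _; rewrite derive1E; exact: (@derive_val _ _ _ _ _ _ _ (Ff x)).
Qed.

End L2Circle.

(** * Trigonometric functions as eigenfunctions *)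

Section Waves.
Context {R : realType}.
Local Notation circle := (@circle_measure R).
Implicit Types (c d x : R) (k j : nat).

(* One family contains the cosines and the sines and is stable under d/dx. *)
Definition wave k c : R -> R := fun x => cos (k%:R * x + c).

Lemma is_derive_wave k c x :
  is_derive x 1 (wave k c) ((k%:R *: wave k (c + pi / 2)) x).
Proof.
have -> : wave k c = cos \o (k%:R *: id + cst c) by [].
apply: is_derive_eq.
change (- sin (k%:R * x + c) * (k%:R * 1 + 0) =
        k%:R * cos (k%:R * x + (c + pi / 2))).
by rewrite addrA cosDpihalf; ring.
Qed.

Lemma derive1_wave k c : derive1 (wave k c) = k%:R *: wave k (c + pi / 2).
Proof.
apply/funext => x; rewrite derive1E.
exact: (@derive_val _ _ _ _ _ _ _ (is_derive_wave k c x)).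
Qed.

Lemma continuous_wave k c : continuous (wave k c).
Proof.
move=> x; apply/differentiable_continuous/derivable1_diffP.
exact: (@ex_derive _ _ _ _ _ _ _ (is_derive_wave k c x)).
Qed.

Lemma wave_L2 k c : wave k c \in L2.
Proof. exact/continuous_L2/continuous_wave. Qed.

Lemma wave_periodic k c : periodic (wave k c) (2 * pi).
Proof.
move=> x; rewrite /wave mulrDr addrAC.
have -> : k%:R * (2 * pi) = (pi *+ 2 : R) *+ k by rewrite -[RHS]mulr_natr; ring.
by rewrite (periodicn (@cosD2pi R)).
Qed.

Lemma waveDpi k c : wave k (c + pi) = - wave k c.
Proof. by apply/funext => x; rewrite /wave addrA cosDpi. Qed.

Lemma wave0 c : wave 0 c = cst (cos c).
Proof. by apply/funext => x; rewrite /wave mul0r add0r. Qed.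

Lemma integral_wave k c : (0 < k)%N -> \int[circle]_x wave k c x = 0.
Proof.
move=> k0; pose F : R -> R := k%:R^-1 *: wave k (c - pi / 2).
have dF (x : R) : is_derive x 1 F (wave k c x).
  have := is_deriveZ k%:R^-1 (is_derive_wave k (c - pi / 2) x).
  rewrite subrK /GRing.scale /= mulrA mulVf ?mul1r //.
  by rewrite pnatr_eq0 -lt0n.
rewrite (circle_FTC dF); last exact: continuous_wave.
have := wave_periodic k (c - pi / 2) 0; rewrite add0r.
by rewrite /F /GRing.scale /= => ->; rewrite subrr.
Qed.

Lemma integral_circle_cst c : \int[circle]_x cst c x = c * (2 * pi).
Proof.
have dF (x : R) : is_derive x 1 (c *: (id : R -> R)) (cst c x).
  have := is_deriveZ c (is_derive_id x (1 : R)).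
  by rewrite /GRing.scale /= mulr1.
rewrite (circle_FTC dF); last exact: cst_continuous.
by change (c * (2 * pi) - c * 0 = c * (2 * pi)); rewrite mulr0 subr0.
Qed.

Lemma waveM j k c d x : (k <= j)%N ->
  wave j c x * wave k d x =
  2^-1 * wave (j + k) (c + d) x + 2^-1 * wave (j - k) (c - d) x.
Proof.
move=> kj; rewrite /wave natrD natrB //.
have -> : (j%:R + k%:R) * x + (c + d) = (j%:R * x + c) + (k%:R * x + d) by ring.
have -> : (j%:R - k%:R) * x + (c - d) = (j%:R * x + c) - (k%:R * x + d) by ring.
set A := j%:R * x + c; set B := k%:R * x + d. by rewrite (cosD A B) (cosB A B); field.
Qed.

Lemma inner_wave_sum2 j k c d : (k <= j)%N ->
  inner (wave j c) (wave k d) =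
  2^-1 * \int[circle]_x wave (j + k) (c + d) x +
  2^-1 * \int[circle]_x wave (j - k) (c - d) x.
Proof.
move=> kj; have i1 i e : circle.-integrable setT (EFin \o wave i e).
  apply/Lfun1_integrable.
  (* Multiplying by the constant 1 of L^2, here [wave 0 0], turns square integrability into
     integrability. *)
  have := Lfun2_mul_Lfun1 (wave_L2 i e) (wave_L2 0 0).
  rewrite wave0 cos0.
  by rewrite (_ : wave i e \* _ = wave i e) //; apply/funext => x; rewrite /= mulr1.
rewrite -!RintegralZl // -RintegralD //.
- by apply: eq_Rintegral => x _; exact: waveM.
- by have := integrableZl measurableT 2^-1 (i1 (j + k)%N (c + d)); apply: eq_integrable.
- by have := integrableZl measurableT 2^-1 (i1 (j - k)%N (c - d)); apply: eq_integrable.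
Qed.

Lemma inner_wave_neq j k c d : j != k -> inner (wave j c) (wave k d) = 0.
Proof.
wlog kj : j k c d / (k < j)%N.
  move=> H jk; have [kj|jk'] := ltnP k j; first exact: H.
  by rewrite innerC; apply: H; rewrite 1?eq_sym // ltn_neqAle jk.
by move=> _; rewrite inner_wave_sum2 1?ltnW // !integral_wave ?mulr0 ?addr0 //; lia.
Qed.

(** The value is [pi] for positive [k] and [2 * pi * cos c ^+ 2] for [k = 0]. *)
Lemma inner_wave_le k c : inner (wave k c) (wave k c) <= 2 * pi.
Proof.
have p0 := pi_ge0 R.
rewrite inner_wave_sum2 // subrr subnn wave0 integral_circle_cst cos0.
case: k => [|k]; last by rewrite integral_wave //; lra.
rewrite wave0 integral_circle_cst.
have := ler_wpM2r p0 (cos_le1 (c + c)); nra.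
Qed.

Lemma inner_cst_wave0 c : inner (cst c) (wave 0 0) = c * (2 * pi).
Proof.
rewrite -integral_circle_cst; apply: eq_Rintegral => x _.
by rewrite wave0 cos0 /= mulr1.
Qed.

Lemma inner_cst_wave k c d : (0 < k)%N -> inner (cst c) (wave k d) = 0.
Proof.
move=> k0; have -> : cst c = c *: wave 0 0.
  by apply/funext => x; rewrite wave0 cos0; change (c = c * 1); rewrite mulr1.
rewrite innerZl ?wave_L2 // inner_wave_neq ?mulr0 //.
by rewrite eq_sym -lt0n.
Qed.

Lemma test_function_wave k c : test_function (wave k c).
Proof.
split; first exact: wave_periodic.
move=> n x.
suff -> : derive1n n (wave k c) = k%:R ^+ n *: wave k (c + n%:R * (pi / 2)).
  by apply: derivableZ; exact: (@ex_derive _ _ _ _ _ _ _ (is_derive_wave _ _ _)).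
elim: n => [|n ih]; first by rewrite derive1n0 expr0 scale1r mul0r addr0.
rewrite derive1nS ih; apply/funext => y.
rewrite derive1E deriveZ; last exact: (@ex_derive _ _ _ _ _ _ _ (is_derive_wave _ _ _)).
rewrite -derive1E derive1_wave scalerA -exprSr; congr ((_ *: wave k _) y).
by rewrite -natr1; ring.
Qed.

(** Integration by parts; the boundary terms of [f * phi] cancel by periodicity. *)
Lemma weak_derivative_C1 (f g : R -> R) : periodic f (2 * pi) ->
  (forall x : R, is_derive x 1 f (g x)) -> continuous g -> weak_derivative f g.
Proof.
move=> fp fg cg phi [phip phid].
have cf : continuous f.
  move=> x; apply/differentiable_continuous/derivable1_diffP.
  exact: (@ex_derive _ _ _ _ _ _ _ (fg x)).
have dphi x : is_derive x 1 phi (derive1 phi x).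
  by rewrite derive1E; apply: DeriveDef => //; exact: (phid 0%N x).
have cphi : continuous phi.
  by move=> x; apply/differentiable_continuous/derivable1_diffP; exact: (phid 0%N x).
have cphi' : continuous (derive1 phi).
  by move=> x; apply/differentiable_continuous/derivable1_diffP; exact: (phid 1%N x).
apply/eqP; rewrite -addr_eq0; apply/eqP.
have i1 (p q : R -> R) : continuous p -> continuous q ->
    circle.-integrable setT (EFin \o (p \* q)).
  move=> cp cq; apply/Lfun1_integrable; apply: Lfun2_mul_Lfun1; exact: continuous_L2.
rewrite /inner -RintegralD //; [|exact: i1..].
have dF (x : R) : is_derive x 1 (f * phi) (f x * derive1 phi x + g x * phi x).
  have := is_deriveM (fg x) (dphi x).
  by rewrite /GRing.scale /= (mulrC (phi x)).
rewrite (circle_FTC dF).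
- have := fp 0; have := phip 0; rewrite !add0r.
  by rewrite /GRing.mul /= => -> ->; rewrite subrr.
- move=> x.
  by have := continuousD (continuousM (cf x) (cphi' x)) (continuousM (cg x) (cphi x)).
Qed.

Lemma eigenpair_wave k c : eigenpairA (k%:R ^+ 2) (wave k c).
Proof.
split; [exact: wave_L2|exact/L2Z/wave_L2|exists (k%:R *: wave k (c + pi / 2))].
split; first exact/L2Z/wave_L2.
  apply: weak_derivative_C1; first exact: wave_periodic.
    exact: is_derive_wave.
  by move=> x; apply: (@continuousM _ _ (cst k%:R)); [exact: cst_continuous|
    exact: continuous_wave].
apply: weak_derivative_C1.
- by move=> x; rewrite /GRing.scale /= wave_periodic.
- move=> x; have := is_deriveZ (k%:R : R) (is_derive_wave k (c + pi / 2) x).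
  rewrite -addrA -splitr waveDpi => H; apply: is_derive_eq H _.
  by change (k%:R * (k%:R * - wave k c x) = - (k%:R ^+ 2 * wave k c x)); ring.
- move=> x; apply: continuousN; apply: (@continuousM _ _ (cst (k%:R ^+ 2))).
    exact: cst_continuous.
  exact: continuous_wave.
Qed.

(* Test the weak equation of e against the wave twice: - <e, w''> = lambda <e, w>. *)
Lemma inner_eigen_wave lambda e k c : eigenpairA lambda e ->
  (k%:R ^+ 2 - lambda) * inner e (wave k c) = 0.
Proof.
move=> [eL _ [g [gL eg gf]]].
have H1 : k%:R * (- 1 * inner e (wave k c)) = - inner g (wave k (c + pi / 2)).
  have := eg _ (test_function_wave k (c + pi / 2)).
  rewrite derive1_wave -addrA -splitr innerZr ?wave_L2 // waveDpi -scaleN1r.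
  by rewrite innerZr ?wave_L2.
have H2 : k%:R * inner g (wave k (c + pi / 2)) = lambda * inner e (wave k c).
  have := gf _ (test_function_wave k c).
  rewrite derive1_wave innerZr ?wave_L2 // -[- (lambda *: e)]scaleN1r scalerA innerZl ?wave_L2 //.
  by move=> ->; rewrite !mulN1r mulNr opprK.
have : k%:R * (k%:R * (- 1 * inner e (wave k c))) = - (lambda * inner e (wave k c)).
  by rewrite H1 mulrN H2.
set i := inner e _ => H.
have -> : (k%:R ^+ 2 - lambda) * i = - (k%:R * (k%:R * (- 1 * i))) - lambda * i by ring.
by rewrite H opprK subrr.
Qed.

(** An eigenfunction [e] either has eigenvalue [k%:R ^+ 2], so that the weights agree, or is
    orthogonal to the wave. *)
Lemma fracpow_wave a alpha k c :
  fracpow a alpha (wave k c) ((k%:R ^+ 2 + a) `^ alpha *: wave k c).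
Proof.
split; [exact: wave_L2|exact/L2Z/wave_L2|move=> lambda e le].
have eL : e \in L2 by case: le.
rewrite innerZl ?wave_L2 //.
have /eqP := inner_eigen_wave k c le.
rewrite mulf_eq0 subr_eq0 innerC => /orP[/eqP <- //|/eqP ->].
by rewrite !mulr0.
Qed.

Lemma C1_wave k c : C1 (wave k c).
Proof.
split=> x; first exact: (@ex_derive _ _ _ _ _ _ _ (is_derive_wave _ _ _)).
rewrite derive1_wave; apply: (@continuousM _ _ (cst k%:R)).
  exact: cst_continuous.
exact: continuous_wave.
Qed.

Lemma wave_inX a alpha k c : wave k c \in inX a alpha.
Proof.
rewrite inE; split; [exact: wave_periodic|split; first exact: C1_wave].
by eexists; exact: fracpow_wave.
Qed.

Lemma sum_wave_L2 (b c : nat -> R) n : \sum_(k < n) b k *: wave k (c k) \in L2.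
Proof.
elim: n => [|n ih]; first by rewrite big_ord0 L2_0.
by rewrite big_ord_recr /=; apply/L2D/L2Z/wave_L2.
Qed.

Lemma inner_sum_wave (b c : nat -> R) n w : w \in L2 ->
  inner w (\sum_(k < n) b k *: wave k (c k)) =
  \sum_(k < n) b k * inner w (wave k (c k)).
Proof.
move=> wL; elim: n => [|n ih]; first by rewrite !big_ord0 innerC inner0l.
rewrite !big_ord_recr /= innerDr ?sum_wave_L2 ?L2Z ?wave_L2 //.
by rewrite innerZr ?wave_L2 // ih.
Qed.

(** Pythagoras: the frequencies are distinct, whatever the phases, and each wave has squared norm at
    most [2 * pi]. *)
Lemma L2norm_sum_wave (b c : nat -> R) n :
  L2norm (\sum_(k < n) b k *: wave k (c k)) ^+ 2 <= 2 * pi * \sum_(k < n) b k ^+ 2.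
Proof.
rewrite L2norm_sqr ?sum_wave_L2 //; elim: n => [|n ih].
  by rewrite !big_ord0 mulr0 inner0l.
rewrite !big_ord_recr /=.
set s := \sum_(k < n) _ in ih *; have sL : s \in L2 by exact: sum_wave_L2.
have eL : b n *: wave n (c n) \in L2 by exact/L2Z/wave_L2.
have sn : inner s (wave n (c n)) = 0.
  rewrite innerC inner_sum_wave ?wave_L2 // big1 // => i _.
  by rewrite inner_wave_neq ?mulr0 // gtn_eqF.
rewrite innerDl ?L2D // !innerDr // !(innerC _ s) !innerZr ?wave_L2 // sn mulr0 addr0.
rewrite add0r mulrDr lerD // innerC innerZr ?wave_L2 //.
by have := ler_wpM2l (sqr_ge0 (b n)) (inner_wave_le n (c n)); nra.
Qed.

End Waves.

(** * Dirichlet kernel *)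

Section Embedding.
Context {R : realType}.
Implicit Types (u v w : R -> R) (x y : R).

Lemma scale_funE (c : R) (f : R -> R) x : (c *: f) x = c * f x.
Proof. by []. Qed.

(** The representative [y] is chosen before [f], so that several periodic functions can be moved to
    it at once. *)
Lemma periodic_shift (T c x : R) : 0 < T ->
  exists2 y, c <= y < c + T & forall f : R -> R, periodic f T -> f y = f x.
Proof.
move=> T0; pose n := Num.floor ((x - c) / T).
have [n1 n2] : n%:~R * T <= x - c /\ x - c < (n + 1)%:~R * T.
  have := floor_itv ((x - c) / T); rewrite -/n => /andP[].
  by rewrite ler_pdivlMr // ltr_pdivrMr.
exists (x - n%:~R * T).
  by move: n2; rewrite intrD mulrDl mul1r => n2; apply/andP; split; lra.
move=> f fT; have fTn := periodicn fT.
case: n n1 n2 => n _ _.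
  by rewrite -[in RHS](subrK (n%:R * T) x) mulr_natl fTn.
by rewrite NegzE mulrNz mulNr opprK -pmulrn mulr_natl fTn.
Qed.

(** Write [sin z] as twice [sin (z / 2) * cos (z / 2)] and apply the mean value theorem to the sine:
    both cosines that appear have arguments in [[0, pi / 4]]. *)
Lemma sin_ge_half (z : R) : 0 <= z <= pi / 2 -> z * cos (pi / 4) ^+ 2 <= sin z.
Proof.
move=> /andP[z0 z1]; have p0 := pi_gt0 R.
have [-> | zn0] := eqVneq z 0; first by rewrite mul0r sin0.
have zp : 0 < z / 2 by rewrite divr_gt0 // lt_def zn0.
have q0 : 0 <= cos (pi / 4) :> R by apply: cos_ge0_pihalf; apply/andP; split; lra.
have cle (t : R) : 0 <= t <= pi / 4 -> cos (pi / 4) <= cos t.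
  move=> /andP[t0 t1]; rewrite leNgt; apply/negP.
  by rewrite ltr_cos ?in_itv /= ?t0 /=; [lra|apply/andP; split; lra|lra].
have [] := @MVT R sin cos 0 (z / 2) zp.
  exact/continuous_subspaceT/continuous_sin.
move=> y; rewrite in_itv /= => /andP[y0 y1]; rewrite sin0 !subr0 => sE.
have -> : z = (z / 2) *+ 2 by field.
rewrite sin_mulr2n sE.
have c1 : cos (pi / 4) <= cos y by apply: cle; apply/andP; split; lra.
have c2 : cos (pi / 4) <= cos (z / 2) by apply: cle; apply/andP; split; lra.
rewrite mulrnAl lerMn2r /= expr2 mulrCA mulrC -mulrA.
rewrite [_ * (z / 2)]mulrC [leRHS]mulrC -mulrA.
rewrite ler_pM2l //.
by rewrite ler_pM.
Qed.

(** On the period centred at [x0], [u] is Lipschitz and the half-angle sine is bounded below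
    linearly. This makes the difference quotient against the denominator of the Dirichlet kernel
    bounded. *)
Lemma dist_le_sin u x0 : periodic u (2 * pi) -> C1 u ->
  exists2 C : R, 0 <= C & forall x, `|u x - u x0| <= C * `|sin ((x - x0) / 2)|.
Proof.
move=> up [ud uc]; have p0 := pi_gt0 R.
pose q : R := cos (pi / 4) ^+ 2.
have q0 : 0 < q by rewrite exprn_gt0 // cos_gt0_pihalf //; apply/andP; split; lra.
have [|L [_ hL]] := @compact_bounded _ _ (derive1 u @` `[x0 - pi, x0 + pi]).
  apply: continuous_compact; last exact: segment_compact.
  exact: continuous_subspaceT.
have {}hL y : x0 - pi <= y <= x0 + pi -> `|derive1 u y| <= L + 1.
  by move=> yI; apply: (hL (L + 1)); [rewrite ltrDl|exists y; rewrite //= in_itv].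
pose M := L + 1.
have M0 : 0 <= M by apply: le_trans (hL x0 _); rewrite ?normr_ge0 //; apply/andP; split; lra.
exists (2 * M / q) => [|x]; first by apply: divr_ge0; [exact: mulr_ge0|exact: ltW].
have p20 : 0 < 2 * pi :> R by lra.
have [y yI yP] := periodic_shift (x0 - pi) x p20.
have <- := yP u up.
(* The half-angle sine only changes sign over [2 * pi], so its absolute value is periodic. *)
have <- := yP (fun x => `|sin ((x - x0) / 2)|); last first.
  move=> z; have -> : (z + 2 * pi - x0) / 2 = (z - x0) / 2 + pi by field.
  by rewrite sinDpi normrN.
have lip : `|u y - u x0| <= M * `|y - x0|.
  have du (z : R) : is_derive z 1 u (derive1 u z).
    by rewrite derive1E; apply: DeriveDef.
  have cu : continuous u by move=> z; apply/differentiable_continuous/derivable1_diffP.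
  have [yx|xy] := leP x0 y.
    have [z zI ->] := MVT_segment yx (fun z _ => du z) (continuous_subspaceT cu).
    by rewrite normrM ler_wpM2r // hL //; move: zI; rewrite in_itv /=; lra.
  have [z zI uE] := MVT_segment (ltW xy) (fun z _ => du z) (continuous_subspaceT cu).
  rewrite distrC uE normrM (distrC y) ler_wpM2r // hL //; move: zI; rewrite in_itv /=; lra.
apply: (le_trans lip).
have -> : 2 * M / q * `|sin ((y - x0) / 2)| = M * (2 / q * `|sin ((y - x0) / 2)|) by ring.
apply: ler_wpM2l => //.
rewrite -ler_pdivrMl ?divr_gt0 // invf_div.
have [yx|xy] := leP x0 y.
  rewrite ger0_norm ?subr_ge0 //; apply: le_trans (ler_norm _).
  apply: le_trans (sin_ge_half _); last by lra.
  by rewrite -/q mulrC; lra.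
rewrite ltr0_norm ?subr_lt0 // -normrN -sinN; apply: le_trans (ler_norm _).
apply: le_trans (sin_ge_half _); last by lra.
by rewrite -/q; lra.
Qed.

(** Cosine form of the kernel: a frequency [k > 0] stands for both exponentials of frequencies [k]
    and [-k]. *)
Definition dirichlet_coef (k : nat) : R := if k is 0%N then 1 else 2.

Definition dirichlet x0 N : R -> R :=
  \sum_(k < N.+1) dirichlet_coef k *: wave k (- (k%:R * x0)).

(* D_N(y) = cot(y/2) sin(N y) + cos(N y) *)
Lemma dirichletE x0 N x :
  sin ((x - x0) / 2) * dirichlet x0 N x =
  cos ((x - x0) / 2) * wave N (- (N%:R * x0) - pi / 2) x +
  sin ((x - x0) / 2) * wave N (- (N%:R * x0)) x.
Proof.
rewrite /dirichlet; set h := (x - x0) / 2.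
have wE k : wave k (- (k%:R * x0)) x = cos (k%:R * h *+ 2).
  by rewrite /wave /h; congr cos; field.
have sE k : wave k (- (k%:R * x0) - pi / 2) x = sin (k%:R * h *+ 2).
  by rewrite -cosBpihalf /wave /h; congr cos; field.
rewrite fct_sumE wE sE; elim: N => [|N ih].
  by rewrite big_ord1 scale_funE wE mul0r mul0rn cos0 sin0 /=; ring.
rewrite big_ord_recr mulrDr ih scale_funE wE /dirichlet_coef.
(* The closed form is the sine of [(2N + 1)h], which is re-expanded from the next frequency as
   [2(N + 1)h - h]. *)
have -> : cos h * sin (N%:R * h *+ 2) + sin h * cos (N%:R * h *+ 2) =
          sin (N.+1%:R * h *+ 2 - h).
  have -> : N.+1%:R * h *+ 2 - h = N%:R * h *+ 2 + h by rewrite -natr1; ring.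
  by rewrite (sinD (N%:R * h *+ 2) h); ring.
by rewrite (sinB (N.+1%:R * h *+ 2) h); ring.
Qed.

End Embedding.

(** * The embedding of X into bounded functions *)

Section Sobolev.
Context {R : realType}.
Local Notation circle := (@circle_measure R).
Implicit Types (u v w : R -> R) (x y : R).

(** Telescoping: [1/(m + 1)^2] is at most [1/m - 1/(m + 1)]. *)
Lemma sum_inv_sqr_le2 N : \sum_(k < N) (k.+1%:R ^+ 2)^-1 <= 2 :> R.
Proof.
suff le (n : nat) : \sum_(k < n.+1) (k.+1%:R ^+ 2)^-1 <= 2 - n.+1%:R^-1 :> R.
  case: N => [|N]; first by rewrite big_ord0.
  by apply: le_trans (le N) _; rewrite gerBl invr_ge0.
elim: n => [|n ih]; first by rewrite big_ord1 expr1n invr1; lra.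
rewrite big_ord_recr /=; apply: le_trans (lerD ih (lexx _)) _.
set m : R := n.+1%:R; have m0 : 0 < m by rewrite ltr0n.
rewrite -[n.+2%:R]natr1 -/m.
rewrite -subr_ge0.
have -> : 2 - (m + 1)^-1 - (2 - m^-1 + ((m + 1) ^+ 2)^-1) = (m * (m + 1) ^+ 2)^-1.
  by field; rewrite !gt_eqF //; lra.
by rewrite invr_ge0 mulr_ge0 ?sqr_ge0 // ltW.
Qed.

(** Coefficients of [(A + a)^(-alpha)] applied to the Dirichlet kernel. *)
Definition dirichlet_frac_coef (a alpha : R) (k : nat) : R :=
  dirichlet_coef k / (k%:R ^+ 2 + a) `^ alpha.

(** The first summand is the term [k = 0]. For [k >= 1] the denominator is at least [k], since
    [alpha >= 1/2], so the other terms are at most [4/k^2] and sum to at most 8. *)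
Lemma sum_dirichlet_frac_coef (a alpha : R) N : 0 < a -> 1 / 2 <= alpha ->
  \sum_(k < N.+1) dirichlet_frac_coef a alpha k ^+ 2 <= (a `^ alpha) ^- 2 + 8.
Proof.
move=> a0 al; rewrite big_ord_recl /=; apply: lerD.
  by rewrite /dirichlet_frac_coef /= expr0n add0r div1r exprVn.
apply: le_trans (_ : 4 * \sum_(k < N) (k.+1%:R ^+ 2)^-1 <= _); last first.
  by have := sum_inv_sqr_le2 N; lra.
rewrite mulr_sumr; apply: ler_sum => k _.
rewrite /dirichlet_frac_coef /bump /= add1n exprMn exprVn.
have -> : 2 ^+ 2 = 4 :> R by ring.
have : 1 <= k.+1%:R :> R by rewrite ler1n.
rewrite ler_pM2l //; move: k.+1%:R => m m1; have m0 : 0 < m by lra.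
have m2 : 1 <= m ^+ 2 by exact: exprn_ege1.
have mle : m <= (m ^+ 2 + a) `^ alpha.
  have mE : (m ^+ 2) `^ (1 / 2) = m.
    by rewrite div1r powR12_sqrt ?sqr_ge0 // sqrtr_sqr gtr0_norm.
  rewrite -[leLHS]mE; apply: le_trans (_ : (m ^+ 2) `^ alpha <= _).
    by rewrite ler_powR.
  by apply: ge0_ler_powR; rewrite ?nnegrE; lra.
by rewrite lef_pV2 ?posrE ?exprn_gt0 ?(lt_le_trans m0) // lerXn2r ?nnegrE //; lra.
Qed.

Lemma inner_dirichlet_le (a alpha : R) u v x0 N : 0 < a -> 1 / 2 <= alpha ->
  fracpow a alpha u v ->
  `|inner u (dirichlet x0 N)| <=
    Num.sqrt (2 * pi * ((a `^ alpha) ^- 2 + 8)) * L2norm v.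
Proof.
move=> a0 al [uL vL uv].
pose K : R -> R := \sum_(k < N.+1)
  dirichlet_frac_coef a alpha k *: wave k (- (k%:R * x0)).
have -> : inner u (dirichlet x0 N) = inner v K.
  rewrite !(inner_sum_wave _ (fun k => - (k%:R * x0))) //.
  apply: eq_bigr => k _; rewrite (uv _ _ (eigenpair_wave k _)).
  rewrite /dirichlet_frac_coef mulrA divfK // gt_eqF // powR_gt0 //.
  by rewrite ltr_wpDl ?sqr_ge0.
have KL : K \in L2 by exact: (sum_wave_L2 _ (fun k => - (k%:R * x0))).
apply: le_trans (CauchySchwarz_inner vL KL) _.
rewrite mulrC ler_wpM2r ?L2norm_ge0 //.
rewrite -(ger0_norm (L2norm_ge0 K)) -sqrtr_sqr ler_wsqrtr //.
apply: le_trans (L2norm_sum_wave _ (fun k => - (k%:R * x0)) _) _.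
by rewrite ler_wpM2l ?mulr_ge0 ?pi_ge0 // sum_dirichlet_frac_coef.
Qed.

Lemma inner_cst_dirichlet c x0 N : inner (cst c) (dirichlet x0 N) = c * (2 * pi).
Proof.
rewrite (inner_sum_wave _ (fun k => - (k%:R * x0))); last exact/continuous_L2/cst_continuous.
rewrite big_ord_recl /= mul1r mul0r oppr0 inner_cst_wave0 big1 ?addr0 // => k _.
by rewrite inner_cst_wave ?mulr0.
Qed.

(** The inverse is reduced to a real power, which is measurable; at a zero of [f] both sides are 0
    by the convention for [0^-1]. *)
Lemma measurable_fun_inv (f : measurableTypeR R -> R) :
  measurable_fun setT f -> measurable_fun setT (fun x => (f x)^-1).
Proof.
move=> mf; have -> : (fun x => (f x)^-1) = (fun x => f x * (f x ^+ 2) `^ (-1)).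
  apply/funext => x; rewrite powR_inv1 ?sqr_ge0 //.
  by have [->|fx] := eqVneq (f x) 0; [rewrite invr0 mul0r|field].
apply: measurable_funM => //; apply: (measurableT_comp (measurable_powR _)).
exact: measurable_funX.
Qed.

(** The constant [u x0] pairs to [u x0 * (2 * pi)]. In the remainder the closed form of the kernel
    produces [g], which is [u - u x0] times the half-angle cotangent, bounded by [dist_le_sin]. *)
Lemma inner_dirichlet_split u x0 : periodic u (2 * pi) -> C1 u ->
  exists2 g, g \in L2 & forall N,
    inner u (dirichlet x0 N) = u x0 * (2 * pi) +
      (inner g (wave N (- (N%:R * x0) - pi / 2)) +
       inner (u - cst (u x0)) (wave N (- (N%:R * x0)))).
Proof.
move=> up uC1; have [C C0 hC] := dist_le_sin x0 up uC1.
have cu : continuous u.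
  by move=> x; apply/differentiable_continuous/derivable1_diffP; case: uC1.
have cw : continuous (u - cst (u x0)).
  by move=> x; apply: continuousB; [exact: cu|exact: cst_continuous].
have wL := continuous_L2 cw.
have ch : continuous (fun x : R => (x - x0) / 2).
  move=> x; apply: (@continuousM _ _ (fun x => x - x0) (cst 2^-1)); last exact: cst_continuous.
  by apply: continuousB; [exact: cvg_id|exact: cst_continuous].
pose g x := (u x - u x0) * cos ((x - x0) / 2) / sin ((x - x0) / 2).
have gL : g \in L2.
  apply: (@bounded_L2 _ _ C).
    apply: measurable_funM; last first.
      apply: (@measurable_fun_inv (fun x => sin ((x - x0) / 2))).
      apply: continuous_measurable_fun => x.
      by apply: continuous_comp; [exact: ch|exact: continuous_sin].
    apply: continuous_measurable_fun => x.
    apply: (@continuousM _ _ (u - cst (u x0)) (fun x => cos ((x - x0) / 2))); first exact: cw.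
    by apply: continuous_comp; [exact: ch|exact: continuous_cos].
  move=> x _; rewrite /g; have [->|s0] := eqVneq (sin ((x - x0) / 2)) 0.
    by rewrite invr0 mulr0 normr0.
  rewrite !normrM normfV ler_pdivrMr ?normr_gt0 //.
  apply: le_trans (hC x); rewrite -[leRHS]mulr1 ler_wpM2l //.
  exact: cos_max.
exists g => // N.
have eL : dirichlet x0 N \in L2 by exact: (sum_wave_L2 _ (fun k => - (k%:R * x0))).
have cL : cst (u x0) \in L2 by exact/continuous_L2/cst_continuous.
rewrite -[in LHS](subrK (cst (u x0)) u) innerDl // addrC inner_cst_dirichlet; congr (_ + _).
rewrite -RintegralD //; [|by apply/Lfun1_integrable/Lfun2_mul_Lfun1 => //; exact: wave_L2..].
apply: eq_Rintegral => x _.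
have -> : (u - cst (u x0)) x = u x - u x0 by [].
rewrite /g; have [s0|s0] := eqVneq (sin ((x - x0) / 2)) 0.
  (* Where the sine vanishes, [dist_le_sin] forces [u x = u x0], so both sides are 0. *)
  have := hC x; rewrite s0 normr0 mulr0 normr_le0 => /eqP ->.
  by rewrite !mul0r addr0.
have := dirichletE x0 N x => E.
by apply: (mulfI s0); rewrite mulrCA E; field; rewrite s0.
Qed.

(** If the bound failed by a gap [d], summing the split identity over [N < M] would make [M * d] at
    most of order [sqrt M]. *)
Lemma sup_le_fracpow (a alpha : R) : 0 < a -> 1 / 2 <= alpha ->
  exists2 B : R, 0 < B & forall u v x0, periodic u (2 * pi) -> C1 u ->
    fracpow a alpha u v -> `|u x0| <= B * L2norm v.
Proof.
move=> a0 al; have p0 := pi_gt0 R.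
pose B := Num.sqrt (2 * pi * ((a `^ alpha) ^- 2 + 8)).
have B0 : 0 < B.
  by rewrite sqrtr_gt0 mulr_gt0 ?ltr_wpDl ?invr_ge0 ?exprn_ge0 ?powR_ge0 //; lra.
exists (B / (2 * pi)) => [|u v x0 up uC1 uv]; first by rewrite divr_gt0 // mulr_gt0.
have [uL vL _] := uv.
have [g gL hg] := inner_dirichlet_split x0 up uC1.
have wL : u - cst (u x0) \in L2.
  rewrite -scaleN1r; apply: L2D => //; apply: L2Z.
  exact/continuous_L2/cst_continuous.
set w := u - _ in hg wL.
rewrite mulrAC ler_pdivlMr ?mulr_gt0 //.
rewrite leNgt; apply/negP => lt.
pose d := `|u x0| * (2 * pi) - B * L2norm v.
have d0 : 0 < d by rewrite subr_gt0.
pose G := L2norm g + L2norm w.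
have G0 : 0 <= G by rewrite addr_ge0 ?L2norm_ge0.
(* Waves of distinct frequencies are orthogonal, so the error terms sum to O(sqrt M). *)
have key (M : nat) : M%:R * d <= G * Num.sqrt (2 * pi * M%:R).
  (* The shift [c] serves both error terms: [pi / 2] for [g] and 0 for [w]. *)
  pose S c : R -> R := \sum_(N < M) (1 : R) *: wave N (- (N%:R * x0) - c).
  have SL c : S c \in L2 by exact: (sum_wave_L2 (fun=> 1) (fun N => - (N%:R * x0) - c)).
  have Sn c : L2norm (S c) <= Num.sqrt (2 * pi * M%:R).
    rewrite -(ger0_norm (L2norm_ge0 (S c))) -sqrtr_sqr ler_wsqrtr //.
    apply: le_trans (L2norm_sum_wave (fun=> 1) (fun N => - (N%:R * x0) - c) _) _.
    by under eq_bigr do rewrite expr1n; rewrite sumr_const card_ord.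
  have constE (c : R) : M%:R * c = \sum_(N < M) c.
    by rewrite sumr_const card_ord mulr_natl.
  have sumE : M%:R * (u x0 * (2 * pi)) =
      \sum_(N < M) inner u (dirichlet x0 N) - inner g (S (pi / 2)) - inner w (S 0).
    rewrite (inner_sum_wave (fun=> 1) (fun N => - (N%:R * x0) - pi / 2)) //.
    rewrite (inner_sum_wave (fun=> 1) (fun N => - (N%:R * x0) - 0)) //.
    rewrite -!sumrB constE; by apply: eq_bigr => N _; rewrite hg !mul1r subr0; ring.
  have : `|M%:R * (u x0 * (2 * pi))| <=
      M%:R * (B * L2norm v) + G * Num.sqrt (2 * pi * M%:R).
    rewrite sumE /G (mulrDl (L2norm g)) addrA.
    apply: le_trans (ler_normB _ _) _; apply: lerD.
      apply: le_trans (ler_normB _ _) _; apply: lerD.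
        apply: le_trans (ler_norm_sum _ _ _) _.
        by rewrite constE; apply: ler_sum => N _; exact: inner_dirichlet_le.
      apply: le_trans (CauchySchwarz_inner gL (SL _)) _.
      by rewrite ler_wpM2l ?L2norm_ge0.
    apply: le_trans (CauchySchwarz_inner wL (SL _)) _.
    by rewrite ler_wpM2l ?L2norm_ge0.
  rewrite normrM (ger0_norm (ler0n _ _)) normrM (ger0_norm (_ : 0 <= 2 * pi)); last by lra.
  by rewrite /d; lra.
(* This is the threshold beyond which [M * d] exceeds [G * sqrt (2 * pi * M)]. *)
pose M := (Num.truncn (2 * pi * G ^+ 2 / d ^+ 2)).+1.
have Mgt : 2 * pi * G ^+ 2 / d ^+ 2 < M%:R by exact: truncnS_gt.
have M0 : 0 < M%:R :> R by rewrite ltr0n.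
have := key M; rewrite leNgt => /negP; apply.
rewrite -(@ltr_pXn2r _ 2) ?nnegrE ?mulr_ge0 ?sqrtr_ge0 //; [|by lra..].
rewrite exprMn sqr_sqrtr; last by rewrite !mulr_ge0 // ltW.
move: Mgt; rewrite ltr_pdivrMr ?exprn_gt0 // => Mgt.
have -> : (M%:R * d) ^+ 2 = M%:R * (M%:R * d ^+ 2) by ring.
have -> : G ^+ 2 * (2 * pi * M%:R) = M%:R * (2 * pi * G ^+ 2) by ring.
by rewrite ltr_pM2l.
Qed.

Lemma sup_le_normX (a alpha : R) : 0 < a -> 1 / 2 <= alpha ->
  exists2 B : R, 0 < B & forall (u : X a alpha) x, `|u x| <= B * normX u.
Proof.
move=> a0 al; have [B B0 hB] := sup_le_fracpow a0 al; exists B => // u x.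
have := X_funP u; rewrite inE => -[up [uC1 _]].
rewrite -ler_pdivrMl // mulrC; apply: lb_le_inf; first exact: (normX_has_inf u).1.
by move=> _ [v uv <-]; rewrite ler_pdivrMr // mulrC; exact: hB.
Qed.

End Sobolev.

(** * Maximum principle *)

Section MaximumPrinciple.
Context {R : realType}.
Implicit Types (f : R -> R) (x t : R).

Lemma is_derive_quotient f x (d : R) : is_derive x 1 f d -> forall e : R, 0 < e ->
  exists2 r, 0 < r &
    forall h, h != 0 -> `|h| < r -> `|h^-1 * (f (x + h) - f x) - d| < e.
Proof.
move=> fd e e0; have fx := @ex_derive _ _ _ _ _ _ _ fd.
have : (fun h : R => h^-1 *: ((f \o shift x) (h *: (1 : R)) - f x)) @ 0^' --> d.
  by rewrite -(@derive_val _ _ _ _ _ _ _ fd); exact: fx.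
move/cvgrPdist_lt => /(_ e e0) [r r0 H]; exists r => // h h0 hr.
have := H h; rewrite /= sub0r normrN => /(_ hr h0) He.
have : `|d - h^-1 * (f (h * 1 + x) - f x)| < e := He.
by rewrite distrC mulr1 (addrC h).
Qed.

(** The second derivative is known at [c] only. If it were positive, difference quotients would make
    the first derivative positive just to the right of [c], and by the mean value theorem [f] would
    exceed [f c] there. *)
Lemma derive1n2_le0_at_max f c :
  (forall x, derivable f x 1) -> derivable (derive1 f) c 1 ->
  (forall x, f x <= f c) -> derive1n 2 f c <= 0.
Proof.
move=> df ddf fmax; rewrite leNgt; apply/negP => d0.
have cI : c \in `]c - 1, c + 1[ by rewrite in_itv /=; apply/andP; split; lra.
have c1 : c - 1 <= c + 1 by lra.
have f'c : derive1 f c = 0.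
  have := derive1_at_max c1 (fun t _ => df t) cI (fun t _ => fmax t).
  by rewrite derive1E => H; exact: (@derive_val _ _ _ _ _ _ _ H).
have dd : is_derive c 1 (derive1 f) (derive1n 2 f c).
  by rewrite derive1nS derive1E; apply: DeriveDef.
have [r r0 H] := is_derive_quotient dd d0.
have cr : c < c + r / 2 by lra.
have cf : continuous f by move=> x; apply/differentiable_continuous/derivable1_diffP; exact: df.
have dF (x : R) : is_derive x 1 f (derive1 f x).
  by rewrite derive1E; exact: DeriveDef (df x) erefl.
have [z] := MVT cr (fun x _ => dF x) (continuous_subspaceT cf).
rewrite in_itv /= => /andP[cz zr] E.
have zc0 : 0 < z - c by rewrite subr_gt0.
have := H (z - c); rewrite gt_eqF // gtr0_norm // => /(_ isT).
have -> : c + (z - c) = z by ring.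
rewrite f'c subr0 => /(_ ltac:(lra)) /ltr_normlP [].
rewrite opprB ltrBlDr ltrDl => pos _.
have : 0 < derive1 f z.
  by move: pos; rewrite pmulr_rgt0 // invr_gt0.
by have := fmax (c + r / 2); nra.
Qed.

(** Backward quotients are nonnegative. Only earlier times are compared because a maximum over
    [[0, T]] may sit at [T]. *)
Lemma is_derive_ge0_at_left_max f t (d : R) : 0 < t -> is_derive t 1 f d ->
  (forall s, 0 <= s <= t -> f s <= f t) -> 0 <= d.
Proof.
move=> t0 fd fmax; rewrite leNgt; apply/negP => d0.
have nd0 : 0 < - d by rewrite oppr_gt0.
have [r r0 H] := is_derive_quotient fd nd0.
pose h := Num.min (r / 2) t.
have h0 : 0 < h by rewrite lt_min t0 divr_gt0.
have hr : h < r by rewrite gt_min; apply/orP; left; lra.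
have ht : h <= t by rewrite ge_min lexx orbT.
have := H (- h); rewrite oppr_eq0 gt_eqF // normrN gtr0_norm // => /(_ isT hr).
move/ltr_normlP => [_]; rewrite ltrBlDr addNr invrN mulNr oppr_lt0 pmulr_rgt0 ?invr_gt0 //.
by rewrite subr_gt0 ltNge fmax //; apply/andP; split; lra.
Qed.

Definition heat_solution (E : R -> R -> R) : Prop := forall t x, 0 < t ->
  [/\ derivable (E t) x 1, derivable (derive1 (E t)) x 1 &
      is_derive t 1 (fun s => E s x) (derive1n 2 (E t) x)].

(** At a maximum of [W - e * t] with positive time, the time derivative of [W] is at least [e > 0]
    while its second space derivative is at most 0. *)
Theorem heat_maximum_principle (T : R) (W : R -> R -> R) : 0 < T ->
  {within `[0, T] `*` `[0, 2 * pi], continuous (fun p => W p.1 p.2)} ->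
  (forall t, 0 <= t -> periodic (W t) (2 * pi)) ->
  heat_solution W ->
  (forall x, W 0 x <= 0) ->
  forall t x, 0 <= t <= T -> W t x <= 0.
Proof.
move=> T0 cW pW hW W0 t0 x0 /andP[t00 t0T].
have p2 : 0 < 2 * pi :> R by rewrite mulr_gt0 ?pi_gt0.
rewrite leNgt; apply/negP => Wp.
have [x1 + x1P] := periodic_shift 0 x0 p2; rewrite add0r => x1I.
rewrite -(x1P _ (pW _ t00)) in Wp; clear x0 x1P.
(* With this choice [e * T] is half of [W t0 x1], so [V] stays positive at [(t0, x1)]. *)
pose e := W t0 x1 / (2 * T).
have e0 : 0 < e by rewrite divr_gt0 // mulr_gt0.
pose V (p : R * R) := W p.1 p.2 - e * p.1.
pose A : set (R * R) := `[0, T] `*` `[0, 2 * pi].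
have cV : {within A, continuous V}.
  have ce : {within A, continuous (fun p : R * R => e * p.1)}.
    apply: continuous_subspaceT => q.
    by apply: (@continuousM _ _ (cst e) fst); [exact: cst_continuous|exact: cvg_fst].
  by move=> p; exact: (continuousB (cW p) (ce p)).
have [||[t x] + tmax] := @compact_EVT_max _ R V A _ _ cV.
- by exists (0, 0); split; rewrite /= in_itv /= lexx ltW.
- by apply: compact_setX; exact: segment_compact.
rewrite inE => -[/=]; rewrite !in_itv /= => /andP[t_ge0 tT] xI.
have tmax' s y : 0 <= s <= T -> 0 <= y <= 2 * pi -> W s y - e * s <= W t x - e * t.
  by move=> sI yI; apply: (tmax (s, y)); rewrite inE; split; rewrite /= in_itv.
have Vp : 0 < W t x - e * t.
  apply: lt_le_trans (tmax' t0 x1 _ _); last 2 first.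
  - by rewrite t00 t0T.
  - by move/andP: x1I => [-> /ltW].
  have : e * t0 <= e * T by rewrite ler_pM2l.
  have -> : e * T = W t0 x1 / 2 by rewrite /e; field; rewrite gt_eqF.
  by lra.
(* A positive maximum cannot lie at time 0, where [W] is nonpositive. *)
have tp : 0 < t.
  rewrite lt_def t_ge0 andbT; apply/eqP => tE.
  by move: Vp; rewrite tE mulr0 subr0 ltNge W0.
have [dW ddW tW] := hW t x tp.
have dWt y : derivable (W t) y 1 by case: (hW t y tp).
have : derive1n 2 (W t) x <= 0.
  (* By periodicity the maximum over one closed period is global, so [x] may be an endpoint. *)
  apply: derive1n2_le0_at_max => // y.
  have [y1 + y1P] := periodic_shift 0 y p2; rewrite add0r => /andP[y10 y12].
  rewrite -(y1P _ (pW _ t_ge0)).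
  have := tmax' t y1; rewrite t_ge0 tT y10 ltW // => /(_ isT isT).
  by rewrite lerD2r.
suff : 0 <= derive1n 2 (W t) x - e by move=> *; lra.
have dV : is_derive t 1 (fun s => W s x - e * s) (derive1n 2 (W t) x - e).
  have := is_deriveB tW (is_deriveZ e (is_derive_id t (1 : R))).
  by rewrite /GRing.scale /= mulr1.
apply: (is_derive_ge0_at_left_max tp dV) => s /andP[s0 st].
by apply: tmax' => //; rewrite s0 (le_trans st).
Qed.

End MaximumPrinciple.

(** * Uniqueness of the heat semiflow *)

Section HeatSolutions.
Context {R : realType}.
Implicit Types (E F : R -> R -> R).

Lemma derive1_linear (c : R) (f g : R -> R) :
  (forall x, derivable f x 1) -> (forall x, derivable g x 1) ->
  derive1 (c *: f + g) = c *: derive1 f + derive1 g.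
Proof.
move=> df dg; apply/funext => x.
rewrite derive1E (deriveD (derivableZ (df x)) (dg x)) (deriveZ _ (df x)).
by rewrite -!derive1E.
Qed.

Lemma heat_solution_linear (c : R) E F : heat_solution E -> heat_solution F ->
  heat_solution (fun t => c *: E t + F t).
Proof.
move=> hE hF t x t0; have [E1 E2 E3] := hE t x t0; have [F1 F2 F3] := hF t x t0.
have dE y : derivable (E t) y 1 by case: (hE t y t0).
have dF y : derivable (F t) y 1 by case: (hF t y t0).
have D1 := derive1_linear c dE dF.
split.
- exact: (derivableD (derivableZ E1) F1).
- by rewrite D1; exact: (derivableD (derivableZ E2) F2).
- rewrite derive1nS derive1n1 D1.
  have -> : derive1 (c *: derive1 (E t) + derive1 (F t)) x =
            c * derive1n 2 (E t) x + derive1n 2 (F t) x.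
    have dd (f : R -> R) : derivable (derive1 f) x 1 ->
        is_derive x 1 (derive1 f) (derive1n 2 f x).
      by move=> h; rewrite derive1nS derive1n1 derive1E; exact: DeriveDef h erefl.
    rewrite derive1E.
    exact: (@derive_val _ _ _ _ _ _ _ (is_deriveD (is_deriveZ c (dd _ E2)) (dd _ F2))).
  exact: (is_deriveD (is_deriveZ c E3) F3).
Qed.

Lemma heat_solution_wave k (b c : R) :
  heat_solution (fun t => expR (k%:R ^+ 2 * (b - t)) *: wave k c).
Proof.
move=> t x t0; have dw d y : derivable (wave k d) y 1.
  exact: (@ex_derive _ _ _ _ _ _ _ (is_derive_wave k d y)).
have D (s : R) d : derive1 (s *: wave k d) = (s * k%:R) *: wave k (d + pi / 2).
  apply/funext => y; rewrite derive1E deriveZ // -derive1E derive1_wave.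
  by rewrite scalerA.
split; first exact: derivableZ.
  by rewrite D; exact: derivableZ.
have -> : derive1n 2 (expR (k%:R ^+ 2 * (b - t)) *: wave k c) x =
    (- k%:R ^+ 2 * expR (k%:R ^+ 2 * (b - t))) * wave k c x.
  rewrite derive1nS derive1n1 !D -addrA -splitr waveDpi scale_funE.
  have -> : (- wave k c) x = - wave k c x by [].
  by ring.
have dexp : is_derive t 1 (fun s => expR (k%:R ^+ 2 * (b - s)))
    (- k%:R ^+ 2 * expR (k%:R ^+ 2 * (b - t))).
  have -> : (fun s => expR (k%:R ^+ 2 * (b - s))) = expR \o (k%:R ^+ 2 *: (cst b - id)) by [].
  apply: is_derive_eq.
  change (expR (k%:R ^+ 2 * (b - t)) * (k%:R ^+ 2 * (0 - 1)) =
    - k%:R ^+ 2 * expR (k%:R ^+ 2 * (b - t))).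
  by ring.
have := is_deriveM dexp (is_derive_cst (wave k c x) t 1).
by congr is_derive; rewrite /GRing.scale /= mulr0 add0r mulrC.
Qed.

Lemma u0E (b : R) : u0 b =
  expR b *: wave 1 0 + (- (1 / 4 * expR (4 * b)) *: wave 2 0 + (- (3 / 4)) *: wave 0 0).
Proof.
apply/funext => x; rewrite /u0.
change (expR b * cos x - 4^-1 * expR (4 * b) * cos (2 * x) - 3 / 4 =
 expR b * wave 1 0 x + (- (1 / 4 * expR (4 * b)) * wave 2 0 x + - (3 / 4) * wave 0 0 x)).
by rewrite /wave !addr0 (mul1r x) mul0r cos0; field.
Qed.

Lemma heat_solution_cst (c : R) : heat_solution (fun=> cst c).
Proof.
(* At frequency 0, phase 0 gives the constant 1 and phase [pi / 2] the constant 0. *)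
have := heat_solution_linear c (heat_solution_wave 0 0 0) (heat_solution_wave 0 0 (pi / 2)).
by rewrite (_ : (fun t => _) = (fun=> cst c)) //; apply/funext => t; apply/funext => x;
  rewrite !wave0 cos0 cos_pihalf expr0n mul0r expR0;
  change (c * (1 * 1) + 1 * 0 = c); ring.
Qed.

(** The mode of frequency [k] in [u0 b] carries [expR (k^2 * b)], so the heat flow acts by lowering
    [b]. *)
Lemma heat_solution_u0 (b : R) : heat_solution (fun t => u0 (b - t)).
Proof.
have H := heat_solution_linear 1 (heat_solution_wave 1 b 0)
  (heat_solution_linear (- (1 / 4)) (heat_solution_wave 2 b 0)
     (heat_solution_cst (- (3 / 4)))).
rewrite (_ : (fun t => _) = (fun t => 1 *: (expR (1%:R ^+ 2 * (b - t)) *: wave 1 0) +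
  (- (1 / 4) *: (expR (2%:R ^+ 2 * (b - t)) *: wave 2 0) + cst (- (3 / 4))))) //.
apply/funext => t; rewrite u0E; apply/funext => x.
change (expR (b - t) * wave 1 0 x + (- (1 / 4 * expR (4 * (b - t))) * wave 2 0 x +
  - (3 / 4) * wave 0 0 x) =
  1 * (expR (1%:R ^+ 2 * (b - t)) * wave 1 0 x) +
  (- (1 / 4) * (expR (2%:R ^+ 2 * (b - t)) * wave 2 0 x) + - (3 / 4))).
rewrite wave0 cos0 expr1n !mul1r /=.
have -> : 2 ^+ 2 = 4 :> R by ring.
by ring.
Qed.

Lemma continuous_u0 (b : R) : continuous (fun p : R * R => u0 (b - p.1) p.2).
Proof.
have c1 : continuous (fun p : R * R => b - p.1).
  by move=> p; apply: continuousB; [exact: cst_continuous|exact: cvg_fst].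
have cM (f g : R * R -> R) : continuous f -> continuous g -> continuous (f \* g).
  by move=> cf cg p; exact: (continuousM (cf p) (cg p)).
have cC (f : R -> R) (g : R * R -> R) : continuous f -> continuous g -> continuous (f \o g).
  by move=> cf cg p; apply: continuous_comp; [exact: cg|exact: cf].
have cc (c : R) : continuous (cst c : R * R -> R) by exact: cst_continuous.
have c2 : continuous (snd : R * R -> R) by move=> p; exact: cvg_snd.
have A1 := cM _ _ (cC _ _ (@continuous_expR R) c1) (cC _ _ (@continuous_cos R) c2).
have A2 := cM _ _ (cM _ _ (cc 4^-1) (cC _ _ (@continuous_expR R) (cM _ _ (cc 4) c1)))
  (cC _ _ (@continuous_cos R) (cM _ _ (cc 2) c2)).
by move=> p; exact: (continuousB (continuousB (A1 p) (A2 p)) (cc (3 / 4) p)).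
Qed.

Lemma u0_periodic (b : R) : periodic (u0 b) (2 * pi).
Proof.
move=> x; rewrite u0E.
change (expR b * wave 1 0 (x + 2 * pi) + (- (1 / 4 * expR (4 * b)) * wave 2 0 (x + 2 * pi) +
  - (3 / 4) * wave 0 0 (x + 2 * pi)) =
 expR b * wave 1 0 x + (- (1 / 4 * expR (4 * b)) * wave 2 0 x +
  - (3 / 4) * wave 0 0 x)).
by rewrite !wave_periodic.
Qed.

End HeatSolutions.

(** * Orbits of the semiflow: joint continuity and identification with classical solutions *)

Section Semiflow.
Context {R : realType} (a alpha : R).
Context (ha : 0 < a) (hal : 1 / 2 <= alpha).
Local Notation X := (X a alpha).
Context (Phi : R -> X -> X) (hPhi : heat_semiflow Phi).

Lemma semiflow_orbit_continuous (u : X) (t e : R) : 0 <= t -> 0 < e ->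
  exists2 d, 0 < d & forall s, 0 <= s -> `|t - s| < d -> normX (Phi t u - Phi s u) < e.
Proof.
move=> t0 e0; have [[_ _ cPhi] _] := hPhi.
have := cPhi; move/subspace_continuousP => /(_ (t, u) t0) /= H.
have : nbhs (Phi t u) (ball (Phi t u) e) by exact: nbhsx_ballx.
move=> /H /=; rewrite /nbhs /= => -[[A1 A2] /= [A1t A2u] A12].
have [d d0 dA] := (nbhs_ballP _ _).1 A1t.
exists d => // s s0 ds; apply: (A12 (s, u)) => //.
by split; [exact: dA|exact: nbhs_singleton].
Qed.

(** Continuity in time holds in the norm of X, hence uniformly in [x] by the embedding; at the fixed
    time [t] continuity in space is enough. *)
Lemma semiflow_jointly_continuous (u : X) (T : R) :
  {within `[0, T] `*` `[0, 2 * pi], continuous (fun p : R * R => Phi p.1 u p.2)}.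
Proof.
have [B B0 hB] := sup_le_normX ha hal.
apply/subspace_continuousP => -[t x] [/= tI _].
have t0 : 0 <= t by move: tI; rewrite in_itv /= => /andP[].
apply/cvgrPdist_lt => e e0.
have e20 : 0 < e / 2 / B by rewrite !divr_gt0.
have [d d0 hd] := semiflow_orbit_continuous u t0 e20.
have cu : {for x, continuous (Phi t u)}.
  apply/differentiable_continuous/derivable1_diffP.
  by have := X_funP (Phi t u); rewrite inE => -[_ [[du _] _]]; exact: du.
have e2 : 0 < e / 2 by rewrite divr_gt0.
have /cvgrPdist_lt /(_ _ e2) cu2 := cu.
exists ([set s | `|t - s| < d], [set y | `|Phi t u x - Phi t u y| < e / 2]).
  split; last exact: cu2.
  by apply/nbhs_ballP; exists d.
move=> [s y] [/= ds dy] [/= sI _].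
have s0 : 0 <= s by move: sI; rewrite in_itv /= => /andP[].
have -> : Phi t u x - Phi s u y = (Phi t u x - Phi t u y) + (Phi t u - Phi s u) y.
  by change (Phi t u x - Phi s u y = (Phi t u x - Phi t u y) + (Phi t u y - Phi s u y)); ring.
apply: le_lt_trans (ler_normD _ _) _; rewrite [e]splitr; apply: ltrD => //.
apply: le_lt_trans (hB _ _) _.
by rewrite mulrC -ltr_pdivlMr //; exact: hd.
Qed.

Lemma heat_semiflow_unique (u : X) (E : R -> R -> R) :
  continuous (fun p : R * R => E p.1 p.2) ->
  (forall t, periodic (E t) (2 * pi)) -> heat_solution E -> E 0 = X_fun u ->
  forall t, 0 <= t -> X_fun (Phi t u) = E t.
Proof.
move=> cE pE hE E0 t t0; apply/funext => x.
have [[Phi0 _ _] hP] := hPhi.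
pose F s : R -> R := Phi s u.
have hF : heat_solution F.
  move=> s y s0; have [h1 h2] := hP u s y s0; split; [|exact: h1|exact: h2].
  by have := X_funP (Phi s u); rewrite inE => -[_ [[du _] _]]; exact: du.
have pF s : periodic (F s) (2 * pi).
  by have := X_funP (Phi s u); rewrite inE => -[].
(* The horizon [t + 1] is positive even when [t = 0]. *)
have T0 : 0 < t + 1 by lra.
have tI : 0 <= t <= t + 1 by lra.
have cF : {within `[0, t + 1] `*` `[0, 2 * pi], continuous (fun p => F p.1 p.2)}.
  exact: semiflow_jointly_continuous.
have cE' : {within `[0, t + 1] `*` `[0, 2 * pi], continuous (fun p : R * R => E p.1 p.2)}.
  exact: continuous_subspaceT.
have le (P Q : R -> R -> R) : heat_solution P -> heat_solution Q ->
    {within `[0, t + 1] `*` `[0, 2 * pi], continuous (fun p : R * R => P p.1 p.2)} ->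
    {within `[0, t + 1] `*` `[0, 2 * pi], continuous (fun p : R * R => Q p.1 p.2)} ->
    (forall s, periodic (P s) (2 * pi)) -> (forall s, periodic (Q s) (2 * pi)) ->
    P 0 = Q 0 -> P t x <= Q t x.
  move=> hP1 hQ cP cQ pP pQ PQ0.
  suff : -1 * Q t x + P t x <= 0 by lra.
  have cc : {within `[0, t + 1] `*` `[0, 2 * pi], continuous (cst (-1) : R * R -> R)}.
    exact/continuous_subspaceT/cst_continuous.
  have cW : {within `[0, t + 1] `*` `[0, 2 * pi],
      continuous (fun p : R * R => ((-1) *: Q p.1 + P p.1) p.2)}.
    by move=> p; exact: (continuousD (continuousM (cc p) (cQ p)) (cP p)).
  apply: (heat_maximum_principle T0 cW) (heat_solution_linear (-1) hQ hP1) _ _ _ tI.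
  - move=> s _ y; change (-1 * Q s (y + 2 * pi) + P s (y + 2 * pi) = -1 * Q s y + P s y).
    by rewrite pQ pP.
  - by move=> y; change (-1 * Q 0 y + P 0 y <= 0); rewrite PQ0; lra.
have F0 : F 0 = E 0 by rewrite /F Phi0 E0.
by apply/eqP; rewrite eq_le -/(F t x) !le.
Qed.

(** Linearity is not part of [heat_semiflow]; this instance of uniqueness lets UESM be tested
    against the zero orbit. *)
Lemma heat_semiflow0 (t : R) : 0 <= t -> Phi t 0 = 0.
Proof.
move=> t0; apply: val_inj; apply: (@heat_semiflow_unique 0 (fun=> cst 0)) => //.
- exact: cst_continuous.
- exact: heat_solution_cst.
Qed.

Lemma heat_semiflow_u0 (u : X) (b t : R) : X_fun u = u0 b -> 0 <= t ->
  X_fun (Phi t u) = u0 (b - t).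
Proof.
move=> uE t0; apply: (@heat_semiflow_unique u (fun t => u0 (b - t))) => //.
- exact: continuous_u0.
- by move=> s; exact: u0_periodic.
- exact: heat_solution_u0.
- by rewrite subr0.
Qed.

End Semiflow.

(** * Zeros of u_0^b *)

Section ZeroCount.
Context {R : realType}.
Implicit Types (f : R -> R) (x : R).

Lemma counting_le_size (A : set R) (s : seq R) :
  (forall x, A x -> x \in s) -> (counting A <= (size s)%:R%:E :> \bar R)%E.
Proof.
move=> As; have fA : finite_set A.
  by apply: (@sub_finite_set _ _ [set` s]) => //; exact: finite_seq.
rewrite /counting asboolT // lee_fin ler_nat.
apply: (@uniq_leq_size _ (enum_fset (fset_set A)) s) => [|x]; first exact: fset_uniq.
by rewrite in_fset_set // inE; exact: As.
Qed.

Lemma counting_ge_size (A : set R) (s : seq R) : uniq s ->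
  (forall x, x \in s -> A x) -> ((size s)%:R%:E <= counting A :> \bar R)%E.
Proof.
move=> us sA; rewrite /counting; case: asboolP => [fA|_]; last exact: leey.
rewrite lee_fin ler_nat; apply: uniq_leq_size => // x xs.
by rewrite in_fset_set // inE; exact: sA.
Qed.

Lemma cos_eq_acos (c x : R) : 0 <= x < 2 * pi -> cos x = c ->
  x \in [:: acos c; 2 * pi - acos c].
Proof.
move=> /andP[x0 x2] <-; rewrite !inE.
have [xpi|xpi] := leP x pi; first by rewrite cosK ?eqxx // in_itv /= x0.
have -> : cos x = cos (2 * pi - x).
  rewrite -[RHS]cosN opprB -(cosD2pi (x - 2 * pi)).
  by congr cos; ring.
rewrite cosK ?in_itv /=; last by apply/andP; split; lra.
by apply/orP; right; apply/eqP; ring.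
Qed.

(* The discriminant of the quadratic polynomial q with u_0^b = q(cos), up to the
   factor 4, as a function of s = e^b; it is positive since s > 1. *)
Definition u0_disc (s : R) : R := s ^+ 2 * (s ^+ 2 - 1) ^+ 2 * (s ^+ 2 + 2) / 2.

Lemma u0_disc_gt0 (s : R) : 1 < s -> 0 < u0_disc s.
Proof.
move=> s1; have s2 : 1 < s ^+ 2 by rewrite exprn_egt1.
by rewrite divr_gt0 // !mulr_gt0 ?exprn_gt0 //; lra.
Qed.

Lemma u0_cos (b x : R) :
  u0 b x = expR b * cos x - 4^-1 * expR b ^+ 4 * (2 * cos x ^+ 2 - 1) - 3 / 4.
Proof.
rewrite /u0 -expRM_natl; have -> : 4 * b = b *+ 4 by ring.
have -> : 2 * x = x *+ 2 by ring.
by rewrite cos_mulr2n; ring.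
Qed.

Lemma derive1_u0 (b x : R) :
  derive1 (u0 b) x = sin x * (expR b ^+ 4 * cos x - expR b).
Proof.
have H := is_deriveD (is_deriveZ (expR b) (is_derive_wave 1 0 x))
  (is_deriveD (is_deriveZ (- (1 / 4 * expR (4 * b))) (is_derive_wave 2 0 x))
     (is_deriveZ (- (3 / 4)) (is_derive_wave 0 0 x))).
rewrite derive1E u0E (@derive_val _ _ _ _ _ _ _ H).
change (expR b * (1 * cos (1 * x + (0 + pi / 2))) +
  (- (1 / 4 * expR (4 * b)) * (2 * cos (2 * x + (0 + pi / 2))) +
   - (3 / 4) * (0 * cos (0 * x + (0 + pi / 2)))) =
  sin x * (expR b ^+ 4 * cos x - expR b)).
rewrite -expRM_natl (_ : 4 * b = b *+ 4); last by ring.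
rewrite !add0r !cosDpihalf (_ : 2 * x = x *+ 2); last by ring.
by rewrite sin_mulr2n (mul1r x); field.
Qed.

(** The quadratic in [cos x] has at most the two roots [c1], [c2], and each value of the cosine is
    taken at most twice per period. *)
Lemma zero_number_u0_le4 (b : R) : 0 < b -> (zero_number (u0 b) <= 4%:R%:E)%E.
Proof.
move=> b0; have s1 : 1 < expR b by rewrite expR_gt1.
set s := expR b in s1.
have s40 : s ^+ 4 != 0 by rewrite expf_neq0 // gt_eqF //; lra.
pose r := Num.sqrt (u0_disc s).
pose c1 := (s + r) / s ^+ 4; pose c2 := (s - r) / s ^+ 4.
apply: (@counting_le_size _
  [:: acos c1; 2 * pi - acos c1; acos c2; 2 * pi - acos c2]) => x [xI].
rewrite u0_cos -/s => ux.
(* Completing the square: the left side is [u0_disc s - 2 * s ^+ 4 * u0 b x]. *)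
have r2 : (s ^+ 4 * cos x - s) ^+ 2 = r ^+ 2.
  rewrite sqr_sqrtr ?(ltW (u0_disc_gt0 _)) // /u0_disc.
  have -> : (s ^+ 4 * cos x - s) ^+ 2 = s ^+ 2 * (s ^+ 2 - 1) ^+ 2 * (s ^+ 2 + 2) / 2 -
     2 * s ^+ 4 * (s * cos x - 4^-1 * s ^+ 4 * (2 * cos x ^+ 2 - 1) - 3 / 4) by field.
  by rewrite ux mulr0 subr0.
have /orP[/eqP E|/eqP E] : (s ^+ 4 * cos x - s == r) || (s ^+ 4 * cos x - s == - r).
- by rewrite -eqf_sqr r2.
- have : x \in [:: acos c1; 2 * pi - acos c1].
    by apply: cos_eq_acos => //; rewrite /c1 -E addrC subrK mulrC mulKf.
  by rewrite !inE => /orP[] ->; rewrite ?orbT.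
- have : x \in [:: acos c2; 2 * pi - acos c2].
    by apply: cos_eq_acos => //; rewrite /c2 -E addrC subrK mulrC mulKf.
  by rewrite !inE => /orP[] ->; rewrite ?orbT.
Qed.

(** A critical point has [cos x] equal to 1 or -1, where [u0 b] is negative, or lies at the vertex
    of the quadratic, where a zero would make the discriminant vanish. *)
Lemma u0_simple_zeros (b x : R) : 0 < b -> u0 b x = 0 -> derive1 (u0 b) x <> 0.
Proof.
move=> b0; have s1 : 1 < expR b by rewrite expR_gt1.
rewrite u0_cos derive1_u0; set s := expR b in s1 * => ux /eqP.
rewrite mulf_eq0 => /orP[/eqP sx|/eqP E].
  have /eqP := cos2Dsin2 x; rewrite sx expr0n addr0 sqrf_eq1 => /orP[] /eqP cx.
    have /eqP : (s - 1) ^+ 2 * (s ^+ 2 + 2 * s + 3) = 0.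
      by move: ux; rewrite cx => ux; rewrite -[RHS](mulr0 (-4)) -ux; field.
    by rewrite gt_eqF // mulr_gt0 ?exprn_gt0 //; nra.
  have : s + 4^-1 * s ^+ 4 + 3 / 4 = 0.
    by move: ux; rewrite cx => ux; rewrite -[RHS](mulr0 (-1)) -ux; field.
  have : 0 < s ^+ 4 by rewrite exprn_gt0 //; lra.
  by lra.
have := u0_disc_gt0 s1.
have -> : u0_disc s = (s ^+ 4 * cos x - s) ^+ 2 +
     2 * s ^+ 4 * (s * cos x - 4^-1 * s ^+ 4 * (2 * cos x ^+ 2 - 1) - 3 / 4).
  by rewrite /u0_disc; field.
by rewrite ux E expr0n mulr0 addr0 ltxx.
Qed.

(** Six alternating values give five zeros in disjoint open intervals; [N >= 3] keeps the last node
    [5 * pi / N] below [2 * pi]. *)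
Lemma zero_number_gt4 (w : R -> R) (N : nat) : (3 <= N)%N -> continuous w ->
  (forall j, (j <= 5)%N -> 0 < (-1) ^+ j * w (j%:R * (pi / N%:R))) ->
  (4%:R%:E < zero_number w)%E.
Proof.
move=> N3 cw alt; have p0 := pi_gt0 R.
pose h : R := pi / N%:R.
have N0 : 0 < N%:R :> R by rewrite ltr0n; lia.
have h0 : 0 < h by rewrite divr_gt0.
have h6 : h * 3 <= pi by rewrite /h mulrAC ler_pdivrMr // ler_pM2l // ler_nat.
have zex (j : nat) : (j < 5)%N -> exists z, j%:R * h < z < j.+1%:R * h /\ w z = 0.
  move=> j5; have a1 := alt j (ltnW j5); have a2 := alt j.+1 j5.
  rewrite -/h in a1 a2.
  have jh : j%:R * h <= j.+1%:R * h by rewrite ler_pM2r // ler_nat.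
  have [|z] := @IVT R w _ _ 0 jh (continuous_subspaceT cw).
    move: a2 a1; rewrite exprS mulN1r mulNr oppr_gt0 -signr_odd.
    case: (odd j); rewrite ?expr1 ?expr0 ?mulN1r ?mul1r ?oppr_gt0 ?oppr_lt0 => a2 a1.
      by rewrite le_max ge_min (ltW a2) (ltW a1) orbT.
    by rewrite le_max ge_min (ltW a2) (ltW a1) /= ?orbT.
  rewrite in_itv /= => /andP[z1 z2] wz; exists z; split=> //.
  by rewrite !lt_neqAle z1 z2 !andbT; apply/andP; split; apply/eqP => E;
    [move: a1; rewrite E|move: a2; rewrite -E]; rewrite wz mulr0 ltxx.
have /choice [z hz] : forall j : nat, exists z, (j < 5)%N ->
    j%:R * h < z < j.+1%:R * h /\ w z = 0.
  move=> j; have [j5|j5] := ltnP j 5; last by exists 0.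
  by have [z hz] := zex j j5; exists z.
apply: (@lt_le_trans _ _ 5%:R%:E); first by rewrite lte_fin ltr_nat.
have -> : 5%N = size (map z (iota 0 5)) by [].
apply: counting_ge_size.
  rewrite map_inj_in_uniq ?iota_uniq // => i j; rewrite !mem_iota !add0n => /andP[_ i5] /andP[_ j5].
  have [/andP[i1 i2] _] := hz i i5; have [/andP[j1 j2] _] := hz j j5.
  case: (ltngtP i j) => // ij E; exfalso.
    have : i.+1%:R * h <= j%:R * h by rewrite ler_pM2r // ler_nat.
    by rewrite leNgt; apply/negP/negPn; rewrite (lt_trans j1) // -E.
  have : j.+1%:R * h <= i%:R * h by rewrite ler_pM2r // ler_nat.
  by rewrite leNgt; apply/negP/negPn; rewrite (lt_trans i1) // E.
move=> x /mapP[j]; rewrite mem_iota add0n => /andP[_ j5] ->.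
have [/andP[j1 j2] wz] := hz j j5; split => //; apply/andP; split.
  by apply: ltW; apply: le_lt_trans j1; rewrite mulr_ge0 // ltW.
apply: lt_le_trans j2 _; apply: le_trans (_ : 5%:R * h <= _).
  by rewrite ler_pM2r // ler_nat.
by lra.
Qed.

Lemma sin_le_id (x : R) : 0 <= x -> `|sin x| <= x.
Proof.
move=> x0; have dF (y : R) := is_derive_sin y.
have [z _] := MVT_segment x0 (fun y _ => dF y) (continuous_subspaceT (@continuous_sin R)).
rewrite sin0 !subr0 => ->; rewrite normrM (ger0_norm x0) -[leRHS]mul1r ler_wpM2r //.
exact: cos_max.
Qed.

(* u_0^0 = - (1 - cos x)^2 / 2 vanishes to fourth order at x = 0 *)
Lemma u0_0_le (x : R) : 0 <= x -> `|u0 0 x| <= x ^+ 4 / 8.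
Proof.
move=> x0; rewrite u0_cos expR0.
have h0 : 0 <= x / 2 by rewrite divr_ge0.
have -> : cos x = 1 - 2 * sin (x / 2) ^+ 2.
  by rewrite {1}(_ : x = (x / 2) *+ 2) ?cos_mulr2n ?cos2sin2; [ring|field].
have -> : 1 * (1 - 2 * sin (x / 2) ^+ 2) -
  4^-1 * 1 ^+ 4 * (2 * (1 - 2 * sin (x / 2) ^+ 2) ^+ 2 - 1) - 3 / 4 =
  - (2 * `|sin (x / 2)| ^+ 4) :> R.
  have -> : `|sin (x / 2)| ^+ 4 = sin (x / 2) ^+ 4.
    by rewrite -normrX ger0_norm // (_ : 4 = 2 * 2)%N // exprM sqr_ge0.
  by field.
rewrite normrN ger0_norm ?mulr_ge0 ?exprn_ge0 //.
have -> : x ^+ 4 / 8 = 2 * (x / 2) ^+ 4 by field.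
by rewrite ler_pM2l // lerXn2r ?nnegrE // sin_le_id.
Qed.

End ZeroCount.

(** * The cone of index 3 *)

Section ConeBoundary.
Context {R : realType} (a alpha : R).
Context (ha : 0 < a) (halpha : 3 / 4 < alpha < 1).
Local Notation X := (X a alpha).

Let hal : 1 / 2 <= alpha.
Proof. by move/andP: halpha => [? _]; lra. Qed.

Lemma u0_inX (b : R) : u0 b \in inX a alpha.
Proof.
by rewrite u0E; apply: rpredD; [|apply: rpredD]; apply: rpredZ; exact: wave_inX.
Qed.

Lemma u0_cone3 (b : R) (u : X) : 0 < b -> X_fun u = u0 b -> cone (Some 3%N) u.
Proof.
move=> b0 uE; apply: subset_closure; rewrite /= uE; split.
  by move=> x [ux u'x]; exact: (u0_simple_zeros b0 ux).
exact: zero_number_u0_le4.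
Qed.

Lemma normX_wave_le (c d : R) (k : nat) :
  normX (c *: InX (wave_inX a alpha k d)) <=
    `|c| * (k%:R ^+ 2 + a) `^ alpha * Num.sqrt (2 * pi).
Proof.
set p := (k%:R ^+ 2 + a) `^ alpha.
have H : fracpow a alpha (c *: InX (wave_inX a alpha k d) : X) ((c * p) *: wave k d).
  have := fracpow_linear c (fracpow_wave a alpha k d) (fracpow0 a alpha).
  by rewrite !addr0 scalerA.
apply: le_trans (normX_le H) _.
rewrite -(ger0_norm (L2norm_ge0 _)) -sqrtr_sqr L2norm_sqr ?L2Z ?wave_L2 //.
rewrite innerZl ?L2Z ?wave_L2 // innerZr ?wave_L2 // mulrA -expr2.
rewrite sqrtrM ?sqr_ge0 // sqrtr_sqr normrM (ger0_norm (powR_ge0 _ _)).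
by rewrite ler_wpM2l ?mulr_ge0 ?powR_ge0 // ler_wsqrtr // inner_wave_le.
Qed.

(** The power of [A + a] costs at most a multiple of [N^2] because [alpha < 1], against the
    amplitude of order [N^-4]; the cruder bound [K / N] already suffices. *)
Lemma normX_wiggle_small (e : R) : 0 < e -> exists2 N : nat, (3 <= N)%N &
  normX ((20 / N%:R) ^+ 4 *: InX (wave_inX a alpha N 0)) < e.
Proof.
move=> e0; have ple (N : R) : 1 <= N -> (N ^+ 2 + a) `^ alpha <= N ^+ 2 * (1 + a).
  move=> N1; have N2 : 1 <= N ^+ 2 by exact: exprn_ege1.
  apply: le_trans (_ : (N ^+ 2 + a) `^ 1 <= _).
    by move/andP: halpha => [_ /ltW ?]; rewrite ler_powR // (le_trans N2) // lerDl ltW.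
  rewrite powRr1 ?addr_ge0 ?sqr_ge0 ?(ltW ha) // mulrDr mulr1 lerD2l.
  by rewrite -[leLHS]mul1r ler_wpM2r // ltW.
pose C : R := 20 ^+ 4; have C0 : 0 < C by rewrite exprn_gt0.
pose K : R := C * (1 + a) * Num.sqrt (2 * pi).
have K0 : 0 < K.
  apply: mulr_gt0; last by rewrite sqrtr_gt0 mulr_gt0 ?pi_gt0.
  by apply: mulr_gt0 => //; rewrite addr_gt0.
pose N := (Num.truncn (K / e)).+3; exists N => //.
have N1 : 1 <= N%:R :> R by rewrite ler1n.
have NK : K / e < N%:R.
  by apply: lt_le_trans (truncnS_gt _) _; rewrite ler_nat /N leqW.
apply: le_lt_trans (normX_wave_le _ _ _) _; rewrite expr_div_n -/C.
move: C C0 @K K0 @N N1 NK => C C0 K K0 n; move: (n%:R : R) => N N1 NK.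
have N2 : 1 <= N ^+ 2 by exact: exprn_ege1.
have N0 : 0 < N by lra.
rewrite ger0_norm ?divr_ge0 ?exprn_ge0 ?(ltW C0) ?(ltW N0) //.
apply: le_lt_trans (_ : K / N < e); last by rewrite ltr_pdivrMr // mulrC -ltr_pdivrMr.
apply: le_trans (_ : C / N ^+ 4 * (N ^+ 2 * (1 + a)) * Num.sqrt (2 * pi) <= _).
  by rewrite ler_wpM2r // ler_wpM2l ?ple ?divr_ge0 ?exprn_ge0 // ltW.
have -> : C / N ^+ 4 * (N ^+ 2 * (1 + a)) * Num.sqrt (2 * pi) = K / N ^+ 2.
  by rewrite /K; field; rewrite gt_eqF.
by rewrite ler_pM2l // lef_pV2 ?posrE ?exprn_gt0 // expr2 ler_peMl // ltW.
Qed.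

(* A perturbation of size N^-4 and frequency N is small in X, but on the scale 1/N it
   beats u_0^0, which is O(x^4) there. *)
Lemma u0_0_wiggle_alternates (N : nat) (w : R -> R) : (3 <= N)%N ->
  (forall x, `|u0 0 x + (20 / N%:R) ^+ 4 * wave N 0 x - w x| < (20 / N%:R) ^+ 4 / 2) ->
  forall j, (j <= 5)%N -> 0 < (-1) ^+ j * w (j%:R * (pi / N%:R)).
Proof.
move=> N3 hw j j5; have p0 := pi_gt0 R.
have N0 : 0 < N%:R :> R by rewrite ltr0n; lia.
set x := j%:R * (pi / N%:R).
have p4 : pi < 4 :> R by have := pihalf_lt2 R; lra.
have j5' : j%:R <= 5 :> R by rewrite ler_nat.
have x0 : 0 <= x by rewrite mulr_ge0 // divr_ge0 // ltW.
(* The constant 20 bounds [j * pi], by [j <= 5] and [pi < 4]. *)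
have xN : x <= 20 / N%:R.
  rewrite /x mulrA ler_pM2r ?invr_gt0 //.
  by apply: le_trans (_ : 5 * 4 <= _); [rewrite ler_pM // ltW|lra].
have ux := u0_0_le x0.
have {}ux : `|u0 0 x| <= (20 / N%:R) ^+ 4 / 8.
  by apply: le_trans ux _; rewrite ler_pM2r // lerXn2r // nnegrE; lra.
have wE : wave N 0 x = (-1) ^+ j.
  rewrite /wave addr0 /x (_ : N%:R * _ = 0 + pi *+ j); last first.
    by rewrite add0r -[pi *+ j]mulr_natl; field; rewrite gt_eqF.
  by rewrite (alternatingn (@cosDpi R)) cos0 mulr1.
(* At the node the wave contributes its full amplitude with sign [(-1) ^+ j]; [u0 0] and the
   distance to [w] take away at most 1/8 and 1/2 of it. *)
have := hw x; rewrite wE; move: ux.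
have : 0 < (20 / N%:R) ^+ 4 :> R by rewrite exprn_gt0 ?divr_gt0.
move: ((20 / N%:R) ^+ 4) => i i0.
rewrite -signr_odd; case: (odd j); rewrite ?expr0 ?expr1 => /ler_normlP [u1 u2] /ltr_normlP [w1 w2];
  lra.
Qed.

(** The cone is a closure, so membership of [u + g] only yields a nearby [w] with at most four
    zeros; by the embedding [w] is uniformly close and inherits the five sign changes. *)
Lemma u0_0_notin_interior_cone3 (u : X) : X_fun u = u0 0 -> ~ (cone (Some 3%N))° u.
Proof.
move=> uE /nbhs_ballP [r r0 ru].
have [B B0 hB] := sup_le_normX ha hal.
have [N N3 hN] := normX_wiggle_small r0.
pose g : X := (20 / N%:R) ^+ 4 *: InX (wave_inX a alpha N 0).
have : cone (Some 3%N) (u + g).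
  apply: ru; rewrite /ball /= /ballX /= opprD addNKr normX_opp.
  exact: hN.
have N0 : 0 < N%:R :> R by rewrite ltr0n; lia.
(* Dividing by the embedding constant [B] makes the uniform distance less than half the
   amplitude. *)
have e0 : 0 < (20 / N%:R) ^+ 4 / 2 / B :> R by rewrite !divr_gt0 // exprn_gt0 ?divr_gt0.
move=> /(_ _ (nbhsx_ballx (u + g) _ e0)) [w [[_ wz] hw]].
have cw : continuous w.
  move=> x; apply/differentiable_continuous/derivable1_diffP.
  by have := X_funP w; rewrite inE => -[_ [[dw _] _]]; exact: dw.
have alt := @u0_0_wiggle_alternates N w N3.
have := zero_number_gt4 N3 cw (alt _); rewrite ltNge wz => H.
suff : false by []. apply: H => x.
rewrite -uE; apply: le_lt_trans (hB (u + g - w) x) _.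
by rewrite mulrC -ltr_pdivlMr.
Qed.

End ConeBoundary.

(** * Arrival at the boundary of the cone and failure of UESM *)

Theorem mainTheorem7 (R : realType) (a alpha : R)
    (ha : 0 < a) (halpha : 3 / 4 < alpha < 1)
    (Phi : R -> X a alpha -> X a alpha) (hPhi : heat_semiflow Phi) :
  (forall b : R, 0 < b ->
     exists u : X a alpha,
       [/\ X_fun u = u0 b,
           cone (Some 3%N) u &
           boundary (cone (Some 3%N)) (Phi b u)]) /\
  ~ UESM_cones Phi.
Proof.
have hal : 1 / 2 <= alpha by move/andP: halpha => [? _]; lra.
have main b : 0 < b -> exists u : X a alpha,
    [/\ X_fun u = u0 b, cone (Some 3%N) u & boundary (cone (Some 3%N)) (Phi b u)].
  move=> b0; pose u := InX (u0_inX a alpha b); exists u.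
  have uC : cone (Some 3%N) u by exact: u0_cone3 b0 _.
  have ut t := heat_semiflow_u0 ha hal hPhi (erefl : X_fun u = u0 b) (t := t).
  split=> //; split; last first.
    by apply: u0_0_notin_interior_cone3 => //; rewrite ut ?subrr // ltW.
  (* Just before time [b] the orbit is at [u0 e] with [e > 0] small, which lies in the cone; letting
     [e] tend to 0 puts the limit in the closure. *)
  move=> V /nbhs_ballP [r r0 rV].
  have [d d0 hd] := semiflow_orbit_continuous hPhi u (ltW b0) r0.
  pose e := Num.min (d / 2) b.
  have e0 : 0 < e by rewrite lt_min b0 divr_gt0.
  have eb : e <= b by rewrite ge_min lexx orbT.
  have ed : e < d by rewrite gt_min; apply/orP; left; lra.
  have be0 : 0 <= b - e by rewrite subr_ge0.
  exists (Phi (b - e) u); split.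
    by apply: (u0_cone3 e0); rewrite ut // subKr.
  by apply: rV; apply: hd => //; rewrite subKr gtr0_norm.
split=> // H; have [T T0 hT] := H 3%N isT.
(* Taking [b] equal to the UESM time [T] makes the orbit of [u] sit on the boundary exactly when it
   should be interior. *)
have [u [uE uC [_ uI]]] := main T T0.
have u_neq0 : u != 0.
  apply/eqP => u_eq0; have u00 : u0 T = cst 0 by rewrite -uE u_eq0.
  (* The zero function would have a degenerate zero at 0. *)
  by have := u0_simple_zeros (x := 0) T0; rewrite u00 derive1_cst; apply.
apply: uI; have := hT u 0; rewrite subr0 => /(_ uC u_neq0 T (lexx T)).
by rewrite (heat_semiflow0 ha hal hPhi) ?ltW // subr0.
Qed.
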